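(* Let $W$ be a finite complex reflection group with generic Hecke algebra $H$ over $R$, and let $F$ be the splitting field of $H$ described in the context. Assume that $H$ admits a symmetrising trace $\tau : H \to R$. Let $\{b_w : w \in W\}$ be a basis of $H$ as an $R$-module, indexed by the elements of $W$, and let $\{b_w^{\vee} : w \in W\}$ be its dual basis with respect to $\tau$. For any choice of conjugacy class representatives $\{v_C \in C \mid C \in \mathrm{Cl}(W)\}$, the square matrix $(\chi(b_{v_C}^{\vee}))_{\chi, C}$, with $\chi \in \mathrm{Irr}(H\otimes_R F)$ and $C \in \mathrm{Cl}(W)$, is invertible, since it specialises to the character table of $W$; define coefficients $g_{w,C} \in F$ ($w \in W$, $C \in \mathrm{Cl}(W)$) by the condition $$\chi(b_w^{\vee}) = \sum_{C \in \mathrm{Cl}(W)} g_{w,C}\, \chi(b_{v_C}^{\vee}) \quad \text{for all } \chi \in \mathrm{Irr}(H \otimes_R F).$$ For any such choice of conjugacy class representatives $v_C$, the elements $$z_C = \sum_{w \in W} g_{w,C}\, b_w, \qquad C \in \mathrm{Cl}(W),$$ form a basis of the center $Z(H \otimes_R F)$.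
   Context: A complex reflection group $W$ is a finite subgroup of $\mathrm{GL}_n(\mathbb{C})$ generated by pseudo-reflections (non-trivial elements of $W$ whose fixed points in $\mathbb{C}^n$ form a hyperplane). A pseudo-reflection $s \in W$ of order $e_s$ is distinguished if its only non-trivial eigenvalue is $\exp(-2\pi\sqrt{-1}/e_s)$; $S$ denotes the set of distinguished pseudo-reflections of $W$. Let $B$ be the complex braid group of $W$ (the fundamental group of the quotient by $W$ of the complement in $\mathbb{C}^n$ of the reflecting hyperplanes), with its natural surjection $B \to W$. For each $s \in S$ choose indeterminates $u_{s,1}, \dots, u_{s,e_s}$, with $u_{s,j} = u_{t,j}$ if $s$ and $t$ are conjugate in $W$, and let $R = \mathbb{Z}[u_{s,j}, u_{s,j}^{-1}]$ be the Laurent polynomial ring in them. The generic Hecke algebra $H$ of $W$ is the quotient of the group algebra $R[B]$ by the ideal generated by the elements $(\sigma - u_{s,1})(\sigma - u_{s,2})\cdots(\sigma - u_{s,e_s})$, where $s$ runs over the conjugacy classes of $S$ and $\sigma$ over the braided reflections in $B$ associated to $s$ (generators of the monodromy around the corresponding hyperplane, mapping to $s$ in $W$). It is a known theorem (formerly the BMR freeness conjecture) that $H$ is a free $R$-module of rank $|W|$. Splitting field: there is a positive integer $N_W$ associated to $W$ by Malle such that, with indeterminates $v_{s,j}$ satisfying $v_{s,j}^{N_W} = \exp(-2\pi\sqrt{-1}\,j/e_s)\,u_{s,j}$, and $F = \mathbb{C}(v_{s,j})$, the algebra $H \otimes_R F$ is split semisimple. By Tits' deformation theorem, the specialisation $v_{s,j}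 \mapsto 1$ (i.e. $u_{s,j} \mapsto \exp(2\pi\sqrt{-1}\,j/e_s)$) induces a bijection $\mathrm{Irr}(H\otimes_R F) \to \mathrm{Irr}(W)$ of irreducible characters. $\mathrm{Cl}(W)$ is the set of conjugacy classes of $W$. A symmetrising trace is an $R$-linear map $\tau: H \to R$ with $\tau(h_1h_2) = \tau(h_2h_1)$ for all $h_1,h_2\in H$ such that for some (hence every) $R$-basis $\mathcal{B}$ of $H$ the determinant of $(\tau(bb'))_{b,b'\in\mathcal{B}}$ is a unit of $R$. The dual basis is determined by $\tau(b_{w_1} b_{w_2}^{\vee}) = \delta_{w_1,w_2}$ for all $w_1, w_2\in W$.
   Formalization: The matrix need not be invertible for an arbitrarily labelled basis (relabel the basis for S_3); invertibility is proved when each b_w specialises to w, and the g_{w,C} and the basis z_C of the center are obtained for every basis whose matrix is invertible. *)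

(* Defs.v *)
From HB Require Import structures.
From mathcomp Require Import all_boot all_order all_algebra all_fingroup.
From mathcomp Require Import mxrepresentation generic_quotient.
From mathcomp Require mpoly monalg.
Import -(notations) mpoly.
Import -(notations) monalg.
From mathcomp Require Import all_classical all_reals all_analysis.
From mathcomp Require Import continuous_path.
From mathcomp Require Import complex lra.

Set Implicit Arguments.
Unset Strict Implicit.
Unset Printing Implicit Defensive.

Import Order.TTheory GRing.Theory Num.Theory numFieldNormedType.Exports.

Local Open Scope ring_scope.
Local Open Scope quotient_scope.

Definition unit_itv (R : realType) : Type := set_type `[0 : R, 1]%classic.

Section UnitInterval.
Variable R : realType.
Local Notation I := (unit_itv R).

HB.instance Definition _ := Topological.on I.

Fact clamp_subproof (t : R) :
  Num.max 0 (Num.min 1 t) \in `[0 : R, 1]%classic.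
Proof.
by apply/mem_set; rewrite /= in_itv /= le_max lexx ge_max ler01 ge_min lexx.
Qed.

Definition clamp (t : R) : I :=
  @exist R (fun x => x \in `[0 : R, 1]%classic) _ (clamp_subproof t).

Definition uval (t : I) : R := set_val t.

Lemma uval_clamp t : uval (clamp t) = Num.max 0 (Num.min 1 t).
Proof. by []. Qed.

Lemma uvalP (t : I) : (0 <= uval t) && (uval t <= 1).
Proof. by have := set_valP t; rewrite /= in_itv. Qed.

Lemma uval_inj : injective uval.
Proof. by move=> s t /val_inj. Qed.

Lemma clampK (t : I) : clamp (uval t) = t.
Proof.
apply: uval_inj; rewrite uval_clamp; have /andP[t0 t1] := uvalP t.
by rewrite (min_idPr t1) (max_idPr t0).
Qed.

Lemma uval_cont : continuous (uval : I -> R).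
Proof. exact: initial_continuous. Qed.

Lemma min_cont (T : topologicalType) (f g : T -> R) :
  continuous f -> continuous g -> continuous (fun x => Num.min (f x) (g x)).
Proof. by move=> cf cg x; apply: continuous_min; [apply: cf | apply: cg]. Qed.

Lemma max_cont (T : topologicalType) (f g : T -> R) :
  continuous f -> continuous g -> continuous (fun x => Num.max (f x) (g x)).
Proof. by move=> cf cg x; apply: continuous_max; [apply: cf | apply: cg]. Qed.

Lemma clamp_cont : continuous clamp.
Proof.
apply: continuous_comp_initial; apply: max_cont; first exact: cst_continuous.
by apply: min_cont; [exact: cst_continuous | move=> x; exact: cvg_id].
Qed.

Fact zero_one_neq_unit_itv : clamp 0 != clamp 1.
Proof.
apply/eqP => /(congr1 uval); rewrite !uval_clamp.
rewrite minxx (min_idPr (ler01 : 0 <= 1)) maxxx (max_idPr (ler01 : 0 <= 1)).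
by move/eqP; rewrite eq_sym oner_eq0.
Qed.

HB.instance Definition _ := isBiPointed.Build I zero_one_neq_unit_itv.

Lemma uval0 : uval zero = 0.
Proof. by rewrite uval_clamp (min_idPr (ler01 : 0 <= 1)) maxxx. Qed.

Lemma uval1 : uval one = 1.
Proof. by rewrite uval_clamp minxx (max_idPr (ler01 : 0 <= 1)). Qed.

Lemma clamp_le0 t : t <= 0 -> clamp t = zero.
Proof.
move=> t0; apply: uval_inj; rewrite uval0 uval_clamp (min_idPr _) ?(max_idPl t0)//.
exact: le_trans ler01.
Qed.

Lemma clamp_ge1 t : 1 <= t -> clamp t = one.
Proof.
by move=> t1; apply: uval_inj; rewrite uval1 uval_clamp (min_idPl t1) max_r.
Qed.

Lemma uval_clampK t : 0 <= t <= 1 -> uval (clamp t) = t.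
Proof. by case/andP=> t0 t1; rewrite uval_clamp (min_idPr t1) (max_idPr t0). Qed.

Lemma pasting (T Y : topologicalType) (u : T -> R) (c : R) (f g : T -> Y) :
    continuous u -> continuous f -> continuous g ->
    (forall x, u x = c -> f x = g x) ->
  continuous (fun x => if u x <= c then f x else g x).
Proof.
move=> cu cf cg fg x; rewrite /continuous_at => A /= Ax.
have [uc|uc|uc] := ltgtP (u x) c.
- have fA : nbhs x (f @^-1` A)%classic by apply: cf; move: Ax; rewrite (ltW uc).
  have uA : nbhs x (u @^-1` [set z | z < c])%classic.
    by apply: cu; apply: lt_nbhsl.
  by apply: filterS2 fA uA => y /= Ay uy; rewrite /= (ltW uy).
- have gA : nbhs x (g @^-1` A)%classic.
    by apply: cg; move: Ax; rewrite leNgt uc.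
  have uA : nbhs x (u @^-1` [set z | c < z])%classic.
    by apply: cu; apply: lt_nbhsr.
  by apply: filterS2 gA uA => y /= Ay uy; rewrite /= leNgt uy.
- move: Ax; rewrite uc lexx => Ax.
  have fA : nbhs x (f @^-1` A)%classic by exact: cf.
  have gA : nbhs x (g @^-1` A)%classic by apply: cg; rewrite -fg.
  by apply: filterS2 fA gA => y /= fy gy; rewrite /=; case: ifP.
Qed.

End UnitInterval.

Section Continuity.
Variables (R : realType) (T : topologicalType).

Lemma cont_add (f g : T -> R) :
  continuous f -> continuous g -> continuous (fun x => f x + g x).
Proof. by move=> cf cg x; apply: cvgD; [apply: cf | apply: cg]. Qed.

Lemma cont_opp (f : T -> R) : continuous f -> continuous (fun x => - f x).
Proof. by move=> cf x; apply: cvgN; apply: cf. Qed.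

Lemma cont_mul (f g : T -> R) :
  continuous f -> continuous g -> continuous (fun x => f x * g x).
Proof. by move=> cf cg x; apply: cvgM; [apply: cf | apply: cg]. Qed.

Lemma cont_comp (U V : topologicalType) (f : T -> U) (g : U -> V) :
  continuous f -> continuous g -> continuous (fun x => g (f x)).
Proof. by move=> cf cg x; apply: continuous_comp; [apply: cf | apply: cg]. Qed.

Lemma cont_pair (U V : topologicalType) (f : T -> U) (g : T -> V) :
  continuous f -> continuous g -> continuous (fun x => (f x, g x)).
Proof. by move=> cf cg x; apply: cvg_pair; [apply: cf | apply: cg]. Qed.

Lemma cont_clamp (f : T -> R) :
  continuous f -> continuous (fun x => clamp (f x)).
Proof. by move=> cf; apply: cont_comp cf (@clamp_cont R). Qed.

Lemma cont_uval (f : T -> unit_itv R) :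
  continuous f -> continuous (fun x => uval (f x)).
Proof. by move=> cf; apply: cont_comp cf (@uval_cont R). Qed.

Lemma cont_id : continuous (fun x : T => x).
Proof. by move=> x; exact: cvg_id. Qed.

Lemma cont_cst (U : topologicalType) (c : U) : continuous (fun _ : T => c).
Proof. exact: cst_continuous. Qed.

End Continuity.

Lemma cont_fst (T U : topologicalType) : continuous (fun z : T * U => z.1).
Proof. by move=> x; exact: cvg_fst. Qed.

Lemma cont_snd (T U : topologicalType) : continuous (fun z : T * U => z.2).
Proof. by move=> x; exact: cvg_snd. Qed.

Ltac cont := lazymatch goal with
  | |- forall z, continuous_at z ?f => cont_body f
  end
with cont_body f := lazymatch f with
  | (fun x => _ + _) => apply: cont_add; cont
  | (fun x => - _) => apply: cont_opp; cont
  | (fun x => _ * _) => apply: cont_mul; cont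
  | (fun x => Num.min _ _) => apply: min_cont; cont
  | (fun x => Num.max _ _) => apply: max_cont; cont
  | (fun x => uval _) => apply: cont_uval; cont
  | (fun x => clamp _) => apply: cont_clamp; cont
  | (fun x => (_, _)) => apply: cont_pair; cont
  | @uval _ => exact: uval_cont
  | @fst _ _ => exact: cont_fst
  | @snd _ _ => exact: cont_snd
  | (fun x => x) => exact: cont_id
  | (fun x => x.1) => exact: cont_fst
  | (fun x => x.2) => exact: cont_snd
  | (fun x => ?c) => first [exact: cont_cst | idtac]
  | _ => idtac
  end.

Section Paths.
Variables (R : realType) (Y : topologicalType).
Local Notation I := (unit_itv R).
Implicit Types x y z : Y.

Section Operations.
Variables (x y z : Y) (p : {path I from x to y}) (q : {path I from y to z}).

Definition path_cat_fun (t : I) : Y :=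
  if uval t <= 2^-1 then p (clamp (2 * uval t)) else q (clamp (2 * uval t - 1)).

Fact path_cat_cont : continuous path_cat_fun.
Proof.
apply: pasting; first by cont.
- by apply: cont_comp (@cts_fun _ _ _); cont.
- by apply: cont_comp (@cts_fun _ _ _); cont.
move=> t ->; rewrite mulfV ?pnatr_eq0 // subrr clamp_ge1 // clamp_le0 //.
by rewrite path_one path_zero.
Qed.

Fact path_cat_zero : path_cat_fun zero = x.
Proof.
by rewrite /path_cat_fun uval0 invr_ge0 ler0n mulr0 clamp_le0 // path_zero.
Qed.

Fact path_cat_one : path_cat_fun one = z.
Proof.
rewrite /path_cat_fun uval1 leNgt (_ : 2^-1 < 1) /=; last by lra.
by rewrite clamp_ge1 ?path_one //; lra.
Qed.

Definition path_cat : {path I from x to z} :=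
  mk_path path_cat_cont path_cat_zero path_cat_one.

Definition path_rev_fun (t : I) : Y := p (clamp (1 - uval t)).

Fact path_rev_cont : continuous path_rev_fun.
Proof. by apply: cont_comp (@cts_fun _ _ _); cont. Qed.

Fact path_rev_zero : path_rev_fun zero = y.
Proof. by rewrite /path_rev_fun uval0 clamp_ge1 ?path_one ?subr0. Qed.

Fact path_rev_one : path_rev_fun one = x.
Proof. by rewrite /path_rev_fun uval1 clamp_le0 ?path_zero ?subrr. Qed.

Definition path_rev : {path I from y to x} :=
  mk_path path_rev_cont path_rev_zero path_rev_one.

Lemma path_catE t : path_cat t = path_cat_fun t.
Proof. by []. Qed.

Lemma path_revE t : path_rev t = p (clamp (1 - uval t)).
Proof. by []. Qed.

Lemma path_cat_left t :
  uval t <= 2^-1 -> path_cat t = p (clamp (2 * uval t)).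
Proof. by move=> tl; rewrite path_catE /path_cat_fun tl. Qed.

Lemma path_cat_right t :
  2^-1 <= uval t -> path_cat t = q (clamp (2 * uval t - 1)).
Proof.
move=> tr; have [tl|tl] := leP (uval t) 2^-1.
  have tE : uval t = 2^-1 by apply: le_anti; rewrite tl tr.
  rewrite path_cat_left // tE mulfV ?pnatr_eq0 // subrr.
  by rewrite clamp_ge1 // clamp_le0 // path_one path_zero.
by rewrite path_catE /path_cat_fun leNgt tl.
Qed.

Definition path_cst : {path I from x to x} := cst x.

End Operations.

Definition homotopic x y (p q : {path I from x to y}) : Prop :=
  exists h : I * I -> Y,
    [/\ continuous h,
        forall t, h (zero, t) = p t,
        forall t, h (one, t) = q t,
        forall s, h (s, zero) = x &
        forall s, h (s, one) = y].

Lemma homotopic_refl x y (p : {path I from x to y}) : homotopic p p.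
Proof.
exists (fun st => p st.2); split=> [||| s| s] //=; first by apply: cont_comp (@cts_fun _ _ _); cont.
  by rewrite path_zero.
by rewrite path_one.
Qed.

Lemma homotopic_sym x y (p q : {path I from x to y}) :
  homotopic p q -> homotopic q p.
Proof.
case=> h [hc h0 h1 hz ho].
exists (fun st => h (clamp (1 - uval st.1), st.2)); split=> [|t|t|s|s] //=.
- by apply: cont_comp hc; cont.
- by rewrite uval0 subr0 clamp_ge1.
- by rewrite uval1 subrr clamp_le0.
Qed.

Lemma homotopic_trans x y (p q r : {path I from x to y}) :
  homotopic p q -> homotopic q r -> homotopic p r.
Proof.
case=> h [hc h0 h1 hz ho] [k [kc k0 k1 kz ko]].
exists (fun st => if uval st.1 <= 2^-1 then h (clamp (2 * uval st.1), st.2)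
                  else k (clamp (2 * uval st.1 - 1), st.2)).
split=> [|t|t|s|s] /=.
- apply: (pasting (u := fun st : I * I => uval st.1)); first by cont.
  + by apply: cont_comp hc; cont.
  + by apply: cont_comp kc; cont.
  move=> [s t] /= ->; rewrite mulfV ?pnatr_eq0 // subrr clamp_ge1 // clamp_le0 //.
  by rewrite h1 k0.
- by rewrite uval0 invr_ge0 ler0n mulr0 clamp_le0.
- rewrite uval1 ifF; last by apply/negbTE; lra.
  by rewrite clamp_ge1 //; lra.
- by rewrite hz kz; case: ifP.
- by rewrite ho ko; case: ifP.
Qed.

Lemma homotopic_cat x y z (p p' : {path I from x to y})
    (q q' : {path I from y to z}) :
  homotopic p p' -> homotopic q q' -> homotopic (path_cat p q) (path_cat p' q').
Proof.
case=> h [hc h0 h1 hz ho] [k [kc k0 k1 kz ko]].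
exists (fun st => if uval st.2 <= 2^-1 then h (st.1, clamp (2 * uval st.2))
                  else k (st.1, clamp (2 * uval st.2 - 1))).
split=> [|t|t|s|s] /=.
- apply: (pasting (u := fun st : I * I => uval st.2)); first by cont.
  + by apply: cont_comp hc; cont.
  + by apply: cont_comp kc; cont.
  move=> [s t] /= ->; rewrite mulfV ?pnatr_eq0 // subrr clamp_ge1 // clamp_le0 //.
  by rewrite ho kz.
- by rewrite h0 k0.
- by rewrite h1 k1.
- by rewrite uval0 invr_ge0 ler0n mulr0 clamp_le0.
- rewrite uval1 ifF; last by apply/negbTE; lra.
  by rewrite clamp_ge1 //; lra.
Qed.

(* Two reparametrisations of one map with the same endpoints are homotopic. *)
Lemma homotopic_reparam x y (p q : {path I from x to y}) (f : I -> Y)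
    (u v : I -> R) :
    continuous f -> continuous u -> continuous v ->
    (forall t, p t = f (clamp (u t))) -> (forall t, q t = f (clamp (v t))) ->
    u zero = v zero -> u one = v one ->
  homotopic p q.
Proof.
move=> cf cu cv pE qE uv0 uv1.
exists (fun st => f (clamp ((1 - uval st.1) * u st.2 + uval st.1 * v st.2))).
split=> [|t|t|s|s] /=.
- by apply: cont_comp cf; cont; apply: cont_comp; cont.
- by rewrite uval0 subr0 mul1r mul0r addr0 pE.
- by rewrite uval1 subrr mul1r mul0r add0r qE.
- by rewrite -uv0 -mulrDl subrK mul1r -pE path_zero.
- by rewrite -uv1 -mulrDl subrK mul1r -pE path_one.
Qed.

Lemma homotopic_catA x y z w (p : {path I from x to y})
    (q : {path I from y to z}) (r : {path I from z to w}) :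
  homotopic (path_cat p (path_cat q r)) (path_cat (path_cat p q) r).
Proof.
apply/homotopic_sym.
apply: (@homotopic_reparam _ _ _ _ (path_cat (path_cat p q) r) (fun t => uval t)
  (fun t => Num.max (uval t / 2) (Num.max (uval t - 4^-1) (2 * uval t - 1)))).
- exact: cts_fun.
- by cont.
- by cont.
- by move=> t; rewrite clampK.
- move=> t; have /andP[t0 t1] := uvalP t; set m := Num.max _ _.
  have [t2|/ltW t2] := leP (uval t) 2^-1.
    have -> : m = uval t / 2.
      by apply/max_idPl; rewrite ge_max; apply/andP; split; lra.
    have mE : uval (clamp (uval t / 2)) = uval t / 2.
      by apply: uval_clampK; apply/andP; split; lra.
    rewrite path_cat_left // (@path_cat_left _ _ _ _ _ (clamp _)) mE; last by lra.
    by rewrite (_ : 2 * (uval t / 2) = uval t) ?clampK ?path_cat_left //; lra.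
  have sE : uval (clamp (2 * uval t - 1)) = 2 * uval t - 1.
    by apply: uval_clampK; apply/andP; split; lra.
  rewrite path_cat_right //.
  have [t3|/ltW t3] := leP (2 * uval t - 1) 2^-1.
    have -> : m = uval t - 4^-1.
      rewrite /m (max_idPl (_ : 2 * uval t - 1 <= uval t - 4^-1)); last by lra.
      by apply/max_idPr; lra.
    have mE : uval (clamp (uval t - 4^-1)) = uval t - 4^-1.
      by apply: uval_clampK; apply/andP; split; lra.
    rewrite path_cat_left ?sE // (@path_cat_left _ _ _ _ _ (clamp _)) mE; last by lra.
    have nE : uval (clamp (2 * (uval t - 4^-1))) = 2 * (uval t - 4^-1).
      by apply: uval_clampK; apply/andP; split; lra.
    rewrite path_cat_right nE; last by lra.
    by congr (q (clamp _)); lra.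
  have -> : m = 2 * uval t - 1.
    rewrite /m (max_idPr (_ : uval t - 4^-1 <= _)); last by lra.
    by apply/max_idPr; lra.
  by rewrite path_cat_right ?sE // path_cat_right sE.
- by rewrite uval0 mul0r; apply/esym/max_idPl; rewrite ge_max; apply/andP; split; lra.
- rewrite uval1 (max_idPr (_ : 1 - 4^-1 <= 2 * 1 - 1)); last by lra.
  by rewrite (max_idPr _); lra.
Qed.

Lemma homotopic_cat1p x y (p : {path I from x to y}) :
  homotopic (path_cat (path_cst x) p) p.
Proof.
apply: (@homotopic_reparam _ _ _ _ p (fun t => Num.max 0 (2 * uval t - 1))
  (fun t => uval t)).
- exact: cts_fun.
- by cont.
- by cont.
- move=> t; have [t2|/ltW t2] := leP (uval t) 2^-1.
    rewrite path_cat_left // (max_idPl _); last by lra.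
    by rewrite (clamp_le0 (lexx 0)) path_zero.
  by rewrite path_cat_right // (max_idPr _) //; lra.
- by move=> t; rewrite clampK.
- by rewrite uval0; apply/max_idPl; lra.
- by rewrite uval1 (max_idPr _); lra.
Qed.

Lemma homotopic_catp1 x y (p : {path I from x to y}) :
  homotopic (path_cat p (path_cst y)) p.
Proof.
apply: (@homotopic_reparam _ _ _ _ p (fun t => Num.min 1 (2 * uval t))
  (fun t => uval t)).
- exact: cts_fun.
- by cont.
- by cont.
- move=> t; have [t2|/ltW t2] := leP (uval t) 2^-1.
    by rewrite path_cat_left // (min_idPr _) //; lra.
  rewrite path_cat_right // (min_idPl _); last by lra.
  by rewrite (clamp_ge1 (lexx 1)) path_one.
- by move=> t; rewrite clampK.
- by rewrite uval0 (min_idPr _); lra.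
- by rewrite uval1; apply/min_idPl; lra.
Qed.

Lemma homotopic_catVp x y (p : {path I from x to y}) :
  homotopic (path_cat (path_rev p) p) (path_cst y).
Proof.
apply: (@homotopic_reparam _ _ _ _ p
  (fun t => Num.max (1 - 2 * uval t) (2 * uval t - 1)) (fun _ => 1)).
- exact: cts_fun.
- by cont.
- by cont.
- move=> t; have /andP[t0 t1] := uvalP t.
  have [t2|/ltW t2] := leP (uval t) 2^-1.
    rewrite path_cat_left // (max_idPl _); last by lra.
    rewrite path_revE uval_clampK //.
    by apply/andP; split; lra.
  by rewrite path_cat_right // (max_idPr _) //; lra.
- by move=> t; rewrite (clamp_ge1 (lexx 1)) path_one.
- by rewrite uval0 (max_idPl _); lra.
- by rewrite uval1 (max_idPr _); lra.
Qed.

Lemma homotopic_catpV x y (p : {path I from x to y}) :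
  homotopic (path_cat p (path_rev p)) (path_cst x).
Proof.
apply: (@homotopic_reparam _ _ _ _ p
  (fun t => Num.min (2 * uval t) (2 - 2 * uval t)) (fun _ => 0)).
- exact: cts_fun.
- by cont.
- by cont.
- move=> t; have /andP[t0 t1] := uvalP t.
  have [t2|/ltW t2] := leP (uval t) 2^-1.
    by rewrite path_cat_left // (min_idPl _) //; lra.
  rewrite path_cat_right // (min_idPr _); last by lra.
  rewrite path_revE uval_clampK; last by apply/andP; split; lra.
  by congr (p (clamp _)); lra.
- by move=> t; rewrite (clamp_le0 (lexx 0)) path_zero.
- by rewrite uval0 (min_idPl _); lra.
- by rewrite uval1 (min_idPr _); lra.
Qed.

Lemma homotopic_rev x y (p q : {path I from x to y}) :
  homotopic p q -> homotopic (path_rev p) (path_rev q).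
Proof.
case=> h [hc h0 h1 hz ho].
exists (fun st => h (st.1, clamp (1 - uval st.2))); split=> [|t|t|s|s] /=.
- by apply: cont_comp hc; cont.
- by rewrite h0.
- by rewrite h1.
- by rewrite uval0 subr0 clamp_ge1.
- by rewrite uval1 subrr clamp_le0.
Qed.

End Paths.

Section FundamentalGroup.
Variables (R : realType) (Y : topologicalType) (y : Y).
Local Notation loop := {path (unit_itv R) from y to y}.

Definition homotopic_rel (p q : loop) : bool := `[< homotopic p q >].

Fact homotopic_rel_refl : reflexive homotopic_rel.
Proof. by move=> p; apply/asboolP/homotopic_refl. Qed.

Fact homotopic_rel_sym : ssrbool.symmetric homotopic_rel.
Proof. by move=> p q; apply/asboolP/asboolP; apply: homotopic_sym. Qed.

Fact homotopic_rel_trans : transitive homotopic_rel.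
Proof.
by move=> q p r /asboolP pq /asboolP qr; apply/asboolP/(homotopic_trans pq qr).
Qed.

Canonical homotopic_equiv :=
  EquivRel homotopic_rel homotopic_rel_refl homotopic_rel_sym homotopic_rel_trans.

Definition fundamental_group : Type := {eq_quot homotopic_equiv}.

HB.instance Definition _ := EqQuotient.on fundamental_group.
HB.instance Definition _ := Choice.on fundamental_group.

Definition loop_class (p : loop) : fundamental_group := \pi p.

Lemma loop_classP (p q : loop) :
  loop_class p = loop_class q <-> homotopic p q.
Proof.
by split=> [/eqmodP/asboolP|pq] //; apply/eqmodP/asboolP.
Qed.

Lemma loop_classK (a : fundamental_group) : loop_class (repr a) = a.
Proof. exact: reprK. Qed.

Definition pi1_one : fundamental_group := loop_class (path_cst R y).

Definition pi1_mul (a b : fundamental_group) : fundamental_group :=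
  loop_class (path_cat (repr a) (repr b)).

Definition pi1_inv (a : fundamental_group) : fundamental_group :=
  loop_class (path_rev (repr a)).

Lemma pi1_mulE (p q : loop) :
  pi1_mul (loop_class p) (loop_class q) = loop_class (path_cat p q).
Proof.
by apply/loop_classP/homotopic_cat; apply/loop_classP; rewrite loop_classK.
Qed.

Lemma pi1_invE (p : loop) : pi1_inv (loop_class p) = loop_class (path_rev p).
Proof. by apply/loop_classP/homotopic_rev/loop_classP; rewrite loop_classK. Qed.

Fact pi1_mulA : associative pi1_mul.
Proof.
move=> a b c; rewrite -[a]loop_classK -[b]loop_classK -[c]loop_classK.
by rewrite !pi1_mulE; apply/loop_classP/homotopic_catA.
Qed.

Fact pi1_mul1 : left_id pi1_one pi1_mul.
Proof.
move=> a; rewrite -[a]loop_classK pi1_mulE.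
by apply/loop_classP/homotopic_cat1p.
Qed.

Fact pi1_mulr1 : right_id pi1_one pi1_mul.
Proof.
move=> a; rewrite -[a]loop_classK pi1_mulE.
by apply/loop_classP/homotopic_catp1.
Qed.

Fact pi1_mulV : left_inverse pi1_one pi1_inv pi1_mul.
Proof.
move=> a; rewrite -[a]loop_classK pi1_invE pi1_mulE.
by apply/loop_classP/homotopic_catVp.
Qed.

Fact pi1_mulrV : right_inverse pi1_one pi1_inv pi1_mul.
Proof.
move=> a; rewrite -[a]loop_classK pi1_invE pi1_mulE.
by apply/loop_classP/homotopic_catpV.
Qed.

HB.instance Definition _ := isGroup.Build fundamental_group
  pi1_mulA pi1_mul1 pi1_mulr1 pi1_mulV pi1_mulrV.

End FundamentalGroup.

Section GroupAlgebra.
Variables (A : comNzRingType) (G : groupType).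

Definition group_algebra : Type := malg G A.

HB.instance Definition _ := GRing.Lmodule.on group_algebra.

Implicit Types (p q r : group_algebra) (g h : G).

Definition galg_supp p : seq G := finmap.enum_fset (msupp p).
Definition galg_coef p g : A := mcoeff g p.
Definition galg_mono (a : A) g : group_algebra := mkmalgU g a.
Definition galg_elt g : group_algebra := galg_mono 1 g.

Definition galg_mul p q : group_algebra :=
  \sum_(g <- galg_supp p) \sum_(h <- galg_supp q)
    galg_mono (galg_coef p g * galg_coef q h) (g * h)%g.

Lemma galg_ext p q : (forall g, galg_coef p g = galg_coef q g) -> p = q.
Proof. by move=> pq; apply/malgP. Qed.

Lemma galg_monoD g a b : galg_mono (a + b) g = galg_mono a g + galg_mono b g.
Proof. exact: monalgUD. Qed.

Lemma galg_mono0 g : galg_mono 0 g = 0.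
Proof. exact: monalgU0. Qed.

Lemma galg_mono_sum g (s : seq G) (F : G -> A) :
  galg_mono (\sum_(h <- s) F h) g = \sum_(h <- s) galg_mono (F h) g.
Proof. exact: (big_morph _ (galg_monoD g) (galg_mono0 g)). Qed.

Lemma galg_coefD p q g :
  galg_coef (p + q) g = galg_coef p g + galg_coef q g.
Proof. exact: mcoeffD. Qed.

Lemma galg_coefZ a p g : galg_coef (a *: p) g = a * galg_coef p g.
Proof. exact: mcoeffZ. Qed.

Lemma galg_coef_mono a g h : galg_coef (galg_mono a g) h = a *+ (g == h).
Proof. exact: mcoeffU. Qed.

Lemma galgE p : p = \sum_(g <- galg_supp p) galg_mono (galg_coef p g) g.
Proof. exact: monalgE. Qed.

(* A sum over the support may be computed over any larger duplicate-free list. *)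
Lemma galg_sum_widen (M : nmodType) (F : A -> G -> M) p (s : seq G) :
    (forall g, F 0 g = 0) -> uniq s -> {subset galg_supp p <= s} ->
  \sum_(g <- galg_supp p) F (galg_coef p g) g = \sum_(g <- s) F (galg_coef p g) g.
Proof.
move=> F0 us ps; rewrite [RHS](bigID (fun g => g \in galg_supp p)) /=.
rewrite [X in _ = _ + X]big1 ?addr0 => [|g gp].
  rewrite -[RHS]big_filter; apply: perm_big; apply: uniq_perm.
  - exact: finmap.fset_uniq.
  - by rewrite filter_uniq.
  by move=> g; rewrite mem_filter; case: (boolP (g \in _)) => //= /ps.
by rewrite [galg_coef p g]mcoeff_outdom.
Qed.

Definition galg_lin (M : nmodType) (F : A -> G -> M) p : M :=
  \sum_(g <- galg_supp p) F (galg_coef p g) g.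

Lemma galg_lin_mono (M : nmodType) (F : A -> G -> M) a g :
  (forall g, F 0 g = 0) -> galg_lin F (galg_mono a g) = F a g.
Proof.
move=> F0; rewrite /galg_lin (galg_sum_widen (s := [:: g])) // => [|h].
  by rewrite big_seq1 galg_coef_mono eqxx.
rewrite inE; apply: contraLR; rewrite eq_sym => /negPf gh.
by rewrite -mcoeff_eq0; apply/eqP; rewrite [LHS]galg_coef_mono gh.
Qed.

Lemma galg_linD (M : nmodType) (F : A -> G -> M) p q :
    (forall g, F 0 g = 0) -> (forall g a b, F (a + b) g = F a g + F b g) ->
  galg_lin F (p + q) = galg_lin F p + galg_lin F q.
Proof.
move=> F0 FD; set s := undup (galg_supp p ++ galg_supp q ++ galg_supp (p + q)).
have ps : {subset galg_supp p <= s} by move=> g; rewrite mem_undup !mem_cat => ->.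
have qs : {subset galg_supp q <= s}.
  by move=> g; rewrite mem_undup !mem_cat => ->; rewrite orbT.
have pqs : {subset galg_supp (p + q) <= s}.
  by move=> g; rewrite mem_undup !mem_cat => ->; rewrite !orbT.
rewrite /galg_lin (galg_sum_widen F0 (undup_uniq _) ps).
rewrite (galg_sum_widen F0 (undup_uniq _) qs).
rewrite (galg_sum_widen F0 (undup_uniq _) pqs).
by rewrite -big_split; apply: eq_bigr => g _; rewrite galg_coefD FD.
Qed.

Lemma galg_lin0 (M : nmodType) (F : A -> G -> M) : galg_lin F 0 = 0.
Proof.
rewrite /galg_lin (_ : galg_supp 0 = [::]) ?big_nil //.
by rewrite /galg_supp msupp0.
Qed.

Lemma galg_lin_sum (M : nmodType) (F : A -> G -> M) (s : seq G)
    (P : G -> group_algebra) :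
    (forall g, F 0 g = 0) -> (forall g a b, F (a + b) g = F a g + F b g) ->
  galg_lin F (\sum_(g <- s) P g) = \sum_(g <- s) galg_lin F (P g).
Proof.
move=> F0 FD; apply: (big_morph (galg_lin F)); last exact: galg_lin0.
by move=> p q; exact: galg_linD.
Qed.

Fact galg_mul_monol a g q :
  galg_mul (galg_mono a g) q =
    galg_lin (fun b h => galg_mono (a * b) (g * h)%g) q.
Proof.
apply: (@galg_lin_mono _ (fun a g => galg_lin
  (fun b h => galg_mono (a * b) (g * h)%g) q)) => h.
by rewrite /galg_lin big1 // => k _; rewrite mul0r galg_mono0.
Qed.

Fact galg_mul_mono a b g h :
  galg_mul (galg_mono a g) (galg_mono b h) = galg_mono (a * b) (g * h)%g.
Proof.
by rewrite galg_mul_monol galg_lin_mono // => k; rewrite mulr0 galg_mono0.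
Qed.

Fact galg_mulDl : left_distributive galg_mul +%R.
Proof.
move=> p q r; apply: (@galg_linD _ (fun a g => galg_lin
  (fun b h => galg_mono (a * b) (g * h)%g) r)) => [g|g a b].
  by rewrite /galg_lin big1 // => k _; rewrite mul0r galg_mono0.
by rewrite /galg_lin -big_split; apply: eq_bigr => k _; rewrite mulrDl galg_monoD.
Qed.

Fact galg_mulDr : right_distributive galg_mul +%R.
Proof.
move=> p q r; rewrite /galg_mul -big_split; apply: eq_bigr => g _ /=.
apply: (@galg_linD _ (fun b h => galg_mono (galg_coef p g * b) (g * h)%g)).
  by move=> h; rewrite mulr0 galg_mono0.
by move=> h a b; rewrite mulrDr galg_monoD.
Qed.

Fact galg_mul0 p : galg_mul 0 p = 0.
Proof.
exact: (galg_lin0 (fun a g => galg_lin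
  (fun b h => galg_mono (a * b) (g * h)%g) p)).
Qed.

Fact galg_mulr0 p : galg_mul p 0 = 0.
Proof.
rewrite /galg_mul big1 // => g _.
exact: (galg_lin0 (fun b h => galg_mono (galg_coef p g * b) (g * h)%g)).
Qed.

Fact galg_mulA : associative galg_mul.
Proof.
move=> p q r.
have suml (s : seq G) (P : G -> group_algebra) x :
    galg_mul (\sum_(g <- s) P g) x = \sum_(g <- s) galg_mul (P g) x.
  exact: (big_morph (galg_mul^~ x) (fun u v => galg_mulDl u v x) (galg_mul0 x)).
have sumr (s : seq G) (P : G -> group_algebra) x :
    galg_mul x (\sum_(g <- s) P g) = \sum_(g <- s) galg_mul x (P g).
  exact: (big_morph (galg_mul x) (galg_mulDr x) (galg_mulr0 x)).
rewrite (galgE p) !suml; apply: eq_bigr => g _.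
rewrite (galgE q) !(suml, sumr); apply: eq_bigr => h _.
rewrite (galgE r) !(suml, sumr); apply: eq_bigr => k _.
by rewrite !galg_mul_mono mulrA mulgA.
Qed.

Fact galg_mul1 : left_id (galg_elt 1%g) galg_mul.
Proof.
move=> p; rewrite galg_mul_monol [RHS]galgE.
by apply: eq_bigr => g _; rewrite mul1r mul1g.
Qed.

Fact galg_mulr1 : right_id (galg_elt 1%g) galg_mul.
Proof.
move=> p; rewrite [RHS]galgE; apply: eq_bigr => g _.
rewrite (_ : (\sum_(h <- _) _) =
  galg_lin (fun b h => galg_mono (galg_coef p g * b) (g * h)%g) (galg_elt 1%g)) //.
by rewrite galg_lin_mono ?mulr1 ?mulg1 // => k; rewrite mulr0 galg_mono0.
Qed.

Fact galg_one_neq0 : galg_elt 1%g != 0.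
Proof. by rewrite [_ == _]monalgU_eq0 oner_eq0. Qed.

HB.instance Definition _ := GRing.Zmodule_isNzRing.Build group_algebra
  galg_mulA galg_mul1 galg_mulr1 galg_mulDl galg_mulDr galg_one_neq0.

Fact galg_scaleE a p : a *: p = galg_mono a 1%g * p.
Proof.
rewrite [RHS]galg_mul_monol [LHS]malgZ_def /fgscale /galg_lin.
by apply: eq_bigr => g _; rewrite mul1g.
Qed.

Fact galg_mono1C a p : galg_mono a 1%g * p = p * galg_mono a 1%g.
Proof.
rewrite [LHS]galg_mul_monol; apply: eq_bigr => g _.
rewrite (_ : (\sum_(h <- _) _) =
  galg_lin (fun b h => galg_mono (galg_coef p g * b) (g * h)%g)
    (galg_mono a 1%g)) //.
rewrite galg_lin_mono => [|k]; last by rewrite mulr0 galg_mono0.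
by rewrite mul1g mulg1 mulrC.
Qed.

Fact galg_scalerAl a p q : a *: (p * q) = (a *: p) * q.
Proof. by rewrite !galg_scaleE mulrA. Qed.

HB.instance Definition _ :=
  GRing.Lmodule_isLalgebra.Build A group_algebra galg_scalerAl.

Fact galg_scalerAr a p q : a *: (p * q) = p * (a *: q).
Proof.
by rewrite !galg_scaleE !mulrA galg_mono1C.
Qed.

HB.instance Definition _ :=
  GRing.Lalgebra_isAlgebra.Build A group_algebra galg_scalerAr.

Lemma galg_eltM g h : galg_elt (g * h)%g = galg_elt g * galg_elt h.
Proof. by rewrite [RHS]galg_mul_mono mulr1. Qed.

End GroupAlgebra.

Section Laurent.
Variable I : finType.

(* The free abelian group on I, written multiplicatively. *)
Definition lattice : Type := {ffun I -> int}.
HB.instance Definition _ := Choice.on lattice.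

Definition expo (k : lattice) (i : I) : int := (k : {ffun I -> int}) i.

Definition lattice_one : lattice := [ffun=> 0].
Definition lattice_mul (k l : lattice) : lattice :=
  [ffun i => expo k i + expo l i].
Definition lattice_inv (k : lattice) : lattice := [ffun i => - expo k i].
Definition lattice_gen (i : I) : lattice := [ffun j => (j == i)%:R].

Fact lattice_mulC : commutative lattice_mul.
Proof. by move=> k l; apply/ffunP => i; rewrite !ffunE addrC. Qed.

Fact lattice_mulA : associative lattice_mul.
Proof. by move=> k l m; apply/ffunP => i; rewrite !ffunE /expo !ffunE addrA. Qed.

Fact lattice_mul1 : left_id lattice_one lattice_mul.
Proof. by move=> k; apply/ffunP => i; rewrite !ffunE /expo ffunE add0r. Qed.

Fact lattice_mulr1 : right_id lattice_one lattice_mul.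
Proof. by move=> k; rewrite lattice_mulC lattice_mul1. Qed.

Fact lattice_mulV : left_inverse lattice_one lattice_inv lattice_mul.
Proof. by move=> k; apply/ffunP => i; rewrite !ffunE /expo ffunE addNr. Qed.

Fact lattice_mulrV : right_inverse lattice_one lattice_inv lattice_mul.
Proof. by move=> k; rewrite lattice_mulC lattice_mulV. Qed.

HB.instance Definition _ := isGroup.Build lattice
  lattice_mulA lattice_mul1 lattice_mulr1 lattice_mulV lattice_mulrV.

(* The Laurent polynomial ring over the integers in variables indexed by I. *)
Definition laurent : Type := group_algebra int lattice.

HB.instance Definition _ := GRing.NzRing.on laurent.

Fact laurent_mulC : commutative (@GRing.mul laurent).
Proof.
move=> p q; rewrite [LHS]/(galg_mul _ _) [RHS]/(galg_mul _ _) /galg_mul exchange_big.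
apply: eq_bigr => k _; apply: eq_bigr => l _.
by rewrite mulrC; congr galg_mono; exact: lattice_mulC.
Qed.

HB.instance Definition _ :=
  GRing.PzRing_hasCommutativeMul.Build laurent laurent_mulC.

Definition laurent_var (i : I) : laurent := galg_elt int (lattice_gen i).

(* Substitution of [a i] for the variables; a ring morphism when all [a i] are
   nonzero. *)
Definition laurent_eval (K : fieldType) (a : I -> K) (p : laurent) : K :=
  \sum_(k <- galg_supp p) (galg_coef p k)%:~R * \prod_i a i ^ expo k i.

End Laurent.

Section Algebras.

Definition is_basis (A : nzRingType) (M : lmodType A) (I : finType)
    (b : I -> M) : Prop :=
  forall x, exists! c : {ffun I -> A}, x = \sum_i c i *: b i.

Definition central (A : nzRingType) (z : A) : Prop := forall x, z * x = x * z.

Definition is_center_basis (K : fieldType) (A : algType K) (I : finType)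
    (z : I -> A) : Prop :=
  (forall i, central (z i)) /\
  forall x, central x -> exists! c : {ffun I -> K}, x = \sum_i c i *: z i.

Definition two_sided_ideal (A : nzRingType) (J : A -> Prop) : Prop :=
  [/\ J 0, forall x y, J x -> J y -> J (x + y),
      forall a x, J x -> J (a * x) & forall a x, J x -> J (x * a)].

Definition ideal_generated (A : nzRingType) (P : A -> Prop) (x : A) : Prop :=
  forall J, two_sided_ideal J -> (forall y, P y -> J y) -> J x.

(* [iota] exhibits [B] as [A (x)_k K] for [phi : k -> K]: [iota] is [phi]-linear
   and universal among phi-linear maps from [A] to K-modules. *)
Definition scalar_extension (k K : comNzRingType) (phi : k -> K)
    (A : algType k) (B : algType K) (iota : {rmorphism A -> B}) : Prop :=
  (forall r x, iota (r *: x) = phi r *: iota x) /\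
  forall (M : lmodType K) (f : {additive A -> M}),
    (forall r x, f (r *: x) = phi r *: f x) ->
  exists2 g : {linear B -> M}, (forall x, g (iota x) = f x) &
    forall g' : {linear B -> M}, (forall x, g' (iota x) = f x) -> g' =1 g.

(* [A] is isomorphic to a finite product of matrix algebras over [K]. *)
Definition split_semisimple (K : fieldType) (A : algType K) : Prop :=
  exists (m : nat) (d : 'I_m -> nat)
         (rho : forall i, {lrmorphism A -> 'M[K]_((d i).+1)}),
    forall M : (forall i, 'M[K]_((d i).+1)), exists! a, forall i, rho i a = M i.

(* Invariant subspaces are spaces of row vectors, as in mxrepresentation; a
   matrix representation is irreducible on rows iff it is on columns. *)
Definition irreducible_repr (K : fieldType) (A : algType K) (d : nat)
    (rho : {lrmorphism A -> 'M[K]_d.+1}) : Prop :=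
  forall U : 'M[K]_d.+1, (forall a, stablemx U (rho a)) -> U != 0 -> row_full U.

Definition irr_char (K : fieldType) (A : algType K) (chi : A -> K) : Prop :=
  exists (d : nat) (rho : {lrmorphism A -> 'M[K]_d.+1}),
    irreducible_repr rho /\ forall a, chi a = \tr (rho a).

Definition irr_enum (K : fieldType) (A : algType K) (m : nat)
    (chi : 'I_m -> A -> K) : Prop :=
  injective chi /\ forall f, irr_char f <-> exists i, f = chi i.

(* The matrix of the values at the family [y] of the irreducible characters is
   square and invertible; rows are ordered by some enumeration of Irr(A). *)
Definition char_matrix_invertible (K : fieldType) (A : algType K)
    (I : finType) (y : I -> A) : Prop :=
  exists chi : 'I_#|I| -> A -> K, irr_enum chi /\
    (\matrix_(i < #|I|, j < #|I|) chi i (y (enum_val j))) \in unitmx.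

Definition symmetrising_trace (A : comNzRingType) (H : algType A)
    (tau : {scalar H}) : Prop :=
  (forall x y, tau (x * y) = tau (y * x)) /\
  exists (m : nat) (b : 'I_m -> H), is_basis b /\
    exists u : A, u * \det (\matrix_(i < m, j < m) tau (b i * b j)) = 1.

Definition dual_basis (A : comNzRingType) (H : algType A) (I : finType)
    (tau : {scalar H}) (b b' : I -> H) : Prop :=
  forall i j, tau (b i * b' j) = (i == j)%:R.

End Algebras.

Definition Cplx (R : realType) : numClosedFieldType := R[i].

Definition cis (R : realType) (t : R) : Cplx R := Complex (cos t) (sin t).

(* exp (2 pi i j / e) *)
Definition root_unity (R : realType) (e j : nat) : Cplx R :=
  cis (2 * pi * j%:R / e%:R).

Section ReflectionGroup.
Variables (R : realType) (n : nat) (W : finGroupType).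
Local Notation C := (Cplx R).
Local Notation I := (unit_itv R).
Variable rho : mx_representation C [set: W] n.

(* The rank condition says that the fixed vectors form a hyperplane. *)
Definition pseudo_reflection (s : W) : bool :=
  (s != 1%g) && (\rank (rho s - 1%:M) == 1%N).

(* W is identified with its image in GL_n(C), acting on column vectors. *)
Definition complex_reflection_group : Prop :=
  mx_faithful rho /\ <<[set s | pseudo_reflection s]>>%g = [set: W].

(* The nontrivial eigenvalue is exp (- 2 pi i / e_s), e_s being the order of s
   itself. A proper power of a distinguished generator of the stabiliser of a
   hyperplane can then be distinguished too; it has indeterminates, but no braided
   reflection, hence no relation (see [braided_reflection]). *)
Definition distinguished (s : W) : bool :=
  pseudo_reflection s && eigenvalue (rho s) (root_unity R #[s]%g 1)^-1.

Definition conj_class : finType := {K : {set W} | K \in classes [set: W]}.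

Definition refl_class : finType :=
  {K : conj_class | [exists s in val K, distinguished s]}.

Definition refl_order (K : refl_class) : nat := #[fingroup.repr (val (val K))]%g.

(* The pair (K, j) with j : 'I_(e_K) stands for the index (s, j + 1), s in K. *)
Definition hecke_index : finType := {K : refl_class & 'I_(refl_order K)}.

Definition hecke_ring : comNzRingType := laurent hecke_index.

Definition hecke_var (K : refl_class) (j : 'I_(refl_order K)) : hecke_ring :=
  laurent_var (Tagged (fun K => 'I_(refl_order K)) j).

Definition index_root (i : hecke_index) : C :=
  root_unity R (refl_order (tag i)) (tagged i).+1.

Definition hecke_field : fieldType := {fraction mpoly #|hecke_index| C}.

Definition field_const (c : C) : hecke_field := tofrac (mpolyC _ c).

Definition field_var (i : hecke_index) : hecke_field :=
  tofrac (mpolyX C (mnm1 (enum_rank i))).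

(* u_{s,j} |-> exp (2 pi i j / e_s) v_{s,j}^N *)
Definition hecke_to_field (N : nat) : hecke_ring -> hecke_field :=
  laurent_eval (fun i => field_const (index_root i) * field_var i ^+ N).

(* u_{s,j} |-> exp (2 pi i j / e_s), i.e. v_{s,j} |-> 1 *)
Definition hecke_special : hecke_ring -> C := laurent_eval index_root.

Definition hyperplane_complement : set 'cV[C]_n :=
  [set x | forall s, pseudo_reflection s -> rho s *m x != x]%classic.

Definition complement_space : Type := set_type hyperplane_complement.
HB.instance Definition _ := Topological.on complement_space.

Definition vect (x : complement_space) : 'cV[C]_n := set_val x.

Definition orbit_rel (x y : complement_space) : bool :=
  [exists w : W, rho w *m vect x == vect y].

Fact orbit_rel_refl : reflexive orbit_rel.
Proof.
move=> x; apply/existsP; exists 1%g.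
by rewrite (repr_mx1 (G := [group of [set: W]]) rho) mul1mx.
Qed.

Fact orbit_rel_sym : ssrbool.symmetric orbit_rel.
Proof.
suff h x y : orbit_rel x y -> orbit_rel y x by move=> x y; apply/idP/idP; apply: h.
move=> /existsP[w /eqP wx]; apply/existsP; exists (w^-1)%g.
rewrite -wx mulmxA -(repr_mxM (G := [group of [set: W]]) rho) ?in_setT // mulVg.
by rewrite (repr_mx1 (G := [group of [set: W]]) rho) mul1mx.
Qed.

Fact orbit_rel_trans : transitive orbit_rel.
Proof.
move=> y x z /existsP[v /eqP vx] /existsP[w /eqP wy]; apply/existsP.
exists (w * v)%g; rewrite (repr_mxM (G := [group of [set: W]]) rho) ?in_setT //.
by rewrite -mulmxA vx wy.
Qed.

Canonical orbit_equiv :=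
  EquivRel orbit_rel orbit_rel_refl orbit_rel_sym orbit_rel_trans.

Definition orbit_space : Type := quotient_topology {eq_quot orbit_equiv}.
HB.instance Definition _ := Topological.on orbit_space.

Definition orbit_proj (x : complement_space) : orbit_space := \pi x.

Definition braid_group (x0 : complement_space) : groupType :=
  fundamental_group R (orbit_proj x0).

Variable x0 : complement_space.

(* The natural surjection from the braid group to W, as a relation: a loop in
   the orbit space goes to w when it lifts to a path from x0 to w x0. *)
Definition lifts_to (sigma : braid_group x0) (w : W) : Prop :=
  exists (y : complement_space) (gamma : {path I from x0 to y})
         (l : {path I from orbit_proj x0 to orbit_proj x0}),
    [/\ vect y = rho w *m vect x0,
        forall t, l t = orbit_proj (gamma t) & sigma = loop_class l].

Definition fixes_hyperplane (s w : W) : Prop :=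
  forall x : 'cV[C]_n, rho s *m x = x -> rho w *m x = x.

Definition fixator_order (s : W) : nat :=
  #|[set w : W | `[< fixes_hyperplane s w >]]|.

(* A generator of the monodromy around the hyperplane of [s]: go from [x0] along
   [gamma] to [x1 = h + a], with [h] on the hyperplane, [a] in the other eigenspace
   of [s] and no other reflecting hyperplane meeting the disc of the h + z a with
   |z| <= 1; rotate [a] by the angle -2 pi / e, with e the order of the
   pointwise stabiliser of the hyperplane; come back along [gamma]. The rotation
   is by a negative angle because the nontrivial eigenvalue of a distinguished
   reflection is exp (- 2 pi i / e), and paths compose from left to right. *)
Definition monodromy_generator (s : W) (sigma : braid_group x0) : Prop :=
  exists (h a : 'cV[C]_n) (x1 y1 : complement_space)
         (gamma : {path I from x0 to x1}) (delta : {path I from x1 to y1})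
         (g : {path I from orbit_proj x0 to orbit_proj x1})
         (d : {path I from orbit_proj x1 to orbit_proj x1}),
    [/\ rho s *m h = h,
        exists2 c : C, c != 1 & rho s *m a = c *: a,
        vect x1 = h + a &
        forall (t : W) (z : C), pseudo_reflection t -> ~ fixes_hyperplane s t ->
          `|z| <= 1 -> rho t *m (h + z *: a) <> h + z *: a] /\
    [/\ forall t, vect (delta t) =
          h + cis (- (2 * pi * uval t / (fixator_order s)%:R)) *: a,
        forall t, g t = orbit_proj (gamma t),
        forall t, d t = orbit_proj (delta t) &
        sigma = loop_class (path_cat (path_cat g d) (path_rev g))].

Definition braided_reflection (s : W) (sigma : braid_group x0) : Prop :=
  monodromy_generator s sigma /\ lifts_to sigma s.

Local Notation RB := (group_algebra hecke_ring (braid_group x0)).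

Definition hecke_relator (p : RB) : Prop :=
  exists (K : refl_class) (s : W) (sigma : braid_group x0),
    [/\ s \in val (val K), braided_reflection s sigma &
        p = \prod_(j < refl_order K) (galg_elt _ sigma - (hecke_var j)%:A)].

Definition is_hecke_algebra (H : algType hecke_ring)
    (q : {lrmorphism RB -> H}) : Prop :=
  (forall x, exists p, q p = x) /\
  (forall p, q p = 0 <-> ideal_generated hecke_relator p).

(* The ring morphism from H to the group algebra of W over the complex numbers
   induced by the braid group surjection and u_{s,j} |-> exp (2 pi i j / e_s). *)
Definition is_specialisation (H : algType hecke_ring) (q : {lrmorphism RB -> H})
    (theta : {rmorphism H -> group_algebra C W}) : Prop :=
  (forall r x, theta (r *: x) = hecke_special r *: theta x) /\
  (forall sigma w, lifts_to sigma w ->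
     theta (q (galg_elt _ sigma)) = galg_elt C w).

End ReflectionGroup.

(* Main.v *)
Require Import Defs.
From HB Require Import structures.
From mathcomp Require Import all_boot all_order all_algebra all_fingroup.
From mathcomp Require Import mxrepresentation.
From mathcomp Require mpoly monalg.
Import -(notations) mpoly.
Import -(notations) monalg.
From mathcomp Require Import all_classical all_reals all_analysis.
From mathcomp Require Import complex.
From mathcomp Require Import zify.
Import Order.TTheory GRing.Theory Num.Theory numFieldNormedType.Exports.
Local Open Scope ring_scope.
Set Implicit Arguments.
Unset Strict Implicit.
Unset Printing Implicit Defensive.

(** Write C[W] for the group algebra of W over the complex numbers, F for the
    field of the v_{s,j}, and [beta w], [beta' w] for the images in HF of
    [b w], [b' w]. The trace form of H extends to HF, where [beta] and [beta']
    are still dual bases.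

    The center. A linear form f on HF has a dual element
    f* = sum_w f(beta' w) beta w, the element with tau(f* x) = f x, and f* is
    central exactly when f is a trace function. As HF is a product of matrix
    algebras, the irreducible characters span the trace functions, so their
    dual elements span the center. Substituting the definition of the g_{w,C}
    gives chi* = sum_C chi(beta' v_C) z_C: the z_C are obtained from the chi*
    by the inverse of the character matrix, hence are central and span the
    center. They are independent because g_{v_D,C} is 1 if C = D and 0
    otherwise.

    Invertibility of the character matrix. A square matrix over the Laurent
    ring that becomes invertible at v = 1 is invertible over F
    ([specialise_nondegenerate]): its determinant does not vanish at v = 1,
    hence is nonzero. Tits' deformation theorem is replaced by two applications
    of this principle.
    - The |W| elements consisting of the [b' (v C)] and, for each other w, of a
      commutator of basis elements that specialises to w - v_C (C the class of
      w) are independent in C[W], hence form a basis of HF. A trace function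
      that vanishes at all beta'(v_C) is therefore zero
      ([trace_function_eq0]); so the rows of the character matrix are
      independent and there are at most |Cl(W)| characters.
    - The elements z_C' = sum_w b_w b_{v_C} b'_w are central, so the forms
      tau(z_C' x) are trace functions. The matrix of their values at the basis
      elements of the v_D^-1 specialises to the diagonal matrix of the orders
      of the centralisers, so these trace functions are independent and there
      are at least |Cl(W)| characters ([card_conj_class_le]).
    So the matrix is square with independent rows. *)

(** * Products of matrix algebras *)

(** The matrix units E_kl with k != l, and the differences E_kk - E_00, are
    commutators. *)
Lemma mx_trace_function (K : fieldType) n (g : {scalar 'M[K]_n.+1}) :
  (forall M N, g (M * N) = g (N * M)) ->
  forall M, g M = g (delta_mx 0 0) * \tr M.
Proof.
move=> gC M; rewrite [in LHS](matrix_sum_delta M) linear_sum /mxtrace mulr_sumr.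
apply: eq_bigr => k _; rewrite linear_sum (bigD1 k) //= big1 ?addr0 => [|l lk].
  rewrite linearZ mulrC; congr (_ * _).
  have -> : delta_mx k k = delta_mx k 0 * delta_mx 0 k :> 'M[K]_n.+1.
    exact/esym/(mul_delta_mx 0 k k).
  by rewrite gC -[_ * _]/(_ *m _) mul_delta_mx.
rewrite linearZ /= -(mul_delta_mx k k l) -[_ *m _]/(_ * _) gC.
have -> : delta_mx k l * delta_mx k k = 0 :> 'M[K]_n.+1.
  exact: mul_delta_mx_0.
by rewrite linear0 mulr0.
Qed.

Section SplitSemisimple.
Variables (K : fieldType) (A : algType K) (m : nat) (d : 'I_m -> nat).
Variable rho : forall i, {lrmorphism A -> 'M[K]_((d i).+1)}.
Hypothesis rhoP :
  forall M : (forall i, 'M[K]_((d i).+1)), exists! a, forall i, rho i a = M i.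

Lemma joint_repr_inj a a' : (forall i, rho i a = rho i a') -> a = a'.
Proof.
by move=> aa'; have [c [_ cu]] := rhoP (rho^~ a); rewrite -(cu a) // -(cu a').
Qed.

(** The element of [A] that is [M] in the factor [i] and 0 in the others. *)
Definition block i (M : 'M[K]_((d i).+1)) : A :=
  sval (cid (rhoP (dfwith (fun j => 0 : 'M[K]_((d j).+1)) i M))).

Lemma repr_block i M : rho i (block M) = M.
Proof.
by rewrite /block; case: cid => a [ra _] /=; rewrite ra dfwithin.
Qed.

Lemma repr_block_neq i j (M : 'M[K]_((d i).+1)) : i != j -> rho j (block M) = 0.
Proof.
by rewrite /block => ij; case: cid => a [ra _] /=; rewrite ra dfwithout.
Qed.

Lemma block_is_linear i : linear (@block i).
Proof.
move=> c M N; apply: joint_repr_inj => j; rewrite linearP /=.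
have [<-|ij] := eqVneq i j; first by rewrite !repr_block.
by rewrite !repr_block_neq // scaler0 addr0.
Qed.
HB.instance Definition _ i :=
  GRing.isLinear.Build K _ _ _ (@block i) (@block_is_linear i).

Lemma blockM i (M N : 'M[K]_((d i).+1)) : block M * block N = block (M * N).
Proof.
apply: joint_repr_inj => j; rewrite rmorphM /=.
have [<-|ij] := eqVneq i j; first by rewrite !repr_block.
by rewrite !repr_block_neq // mulr0.
Qed.

Lemma block_mulr i (M : 'M[K]_((d i).+1)) a : block M * a = block (M * rho i a).
Proof.
apply: joint_repr_inj => j; rewrite rmorphM /=.
have [<-|ij] := eqVneq i j; first by rewrite !repr_block.
by rewrite !repr_block_neq // mul0r.
Qed.

Lemma sum_block a : a = \sum_i block (rho i a).
Proof.
apply: joint_repr_inj => j; rewrite linear_sum (bigD1 j) //= repr_block.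
by rewrite big1 ?addr0 // => i ij; rewrite repr_block_neq.
Qed.

(** The irreducible characters of a split semisimple algebra span its trace
    functions: only the commutators of each factor matter. *)
Lemma trace_function_expand (f : {scalar A}) :
    (forall x y, f (x * y) = f (y * x)) ->
  exists c : 'I_m -> K, forall a, f a = \sum_i c i * \tr (rho i a).
Proof.
move=> fC; exists (fun i => f (block (delta_mx 0 0 : 'M[K]_((d i).+1)))) => a.
rewrite [in LHS](sum_block a) linear_sum; apply: eq_bigr => i _.
apply: (@mx_trace_function _ _ (f \o @block i)) => M N /=.
by rewrite -!blockM fC.
Qed.

Lemma joint_repr_irreducible i : irreducible_repr (rho i).
Proof.
move=> U Ust U0; have [k [l Ukl]] : exists k l, U k l != 0.
  apply: contrapT => h; move/eqP: U0; apply; apply/matrixP => k l; rewrite mxE.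
  by apply/eqP/negP => Ukl; apply: h; exists k, l; apply/negP.
rewrite -sub1mx; apply/row_subP => r.
have /(_ (block (delta_mx l r))) := Ust; rewrite repr_block => sub.
have -> : row r 1%:M = (U k l)^-1 *: (row k U *m delta_mx l r).
  apply/rowP => s; rewrite !mxE (bigD1 l) //= big1 ?addr0 => [|t tl].
    by rewrite !mxE eqxx /= eq_sym mulKf.
  by rewrite !mxE (negPf tl) mulr0.
rewrite scalemx_sub // -row_mul; exact: submx_trans (row_sub _ _) sub.
Qed.

Lemma joint_char_irr i : irr_char (fun a => \tr (rho i a)).
Proof. by exists (d i), (rho i); split=> //; apply: joint_repr_irreducible. Qed.

Lemma joint_chars_free (c : 'I_m -> K) :
  (forall a, \sum_i c i * \tr (rho i a) = 0) -> forall i, c i = 0.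
Proof.
move=> c0 i.
rewrite -(c0 (block (delta_mx 0 0 : 'M[K]_((d i).+1)))) (bigD1 i) //=.
rewrite repr_block big1 => [|j ji]; last first.
  by rewrite repr_block_neq 1?eq_sym // mxtrace0 mulr0.
rewrite addr0 /mxtrace (bigD1 0) //= big1 => [|k k0]; last first.
  by rewrite mxE (negPf k0).
by rewrite mxE eqxx addr0 mulr1.
Qed.

Lemma joint_char_inj :
  injective (fun i (a : A) => \tr (rho i a)).
Proof.
move=> i j /(congr1 (fun f => f (block (delta_mx 0 0 : 'M[K]_((d i).+1))))) /=.
have [//|ij] := eqVneq i j.
rewrite repr_block repr_block_neq // mxtrace0 /mxtrace (bigD1 0) //=.
rewrite big1 => [|k k0]; last by rewrite mxE (negPf k0).
by rewrite mxE eqxx addr0 => /eqP; rewrite oner_eq0.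
Qed.

(** The representations [rho i] are the only irreducible ones: if [sigma] does
    not kill the idempotent E_kk of the factor [i], a nonzero row u of
    sigma(E_kk) gives a matrix with rows u * sigma(E_kl), which intertwines
    [sigma] with [rho i] and is invertible by irreducibility on both sides. *)
Lemma irr_char_joint (f : A -> K) :
  irr_char f -> exists i, f = (fun a => \tr (rho i a)).
Proof.
case=> n [sigma [sirr fE]].
(* The idempotents E_kk of the factors sum to 1. *)
have [i [k Eik]] : exists i k,
    sigma (block (delta_mx k k : 'M[K]_((d i).+1))) != 0.
  apply: contrapT => h; have /eqP := oner_neq0 'M[K]_n.+1; apply.
  rewrite -(rmorph1 sigma) (sum_block 1) rmorph_sum big1 // => i _ /=.
  have -> : rho i 1 = \sum_k delta_mx k k.
    rewrite rmorph1 -[LHS]/(1%:M) scalar_mx_sum_delta.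
    by apply: eq_bigr => k _; rewrite scale1r.
  rewrite (linear_sum (@block i)) rmorph_sum big1 // => k _.
  by apply/eqP/negP => E0; apply: h; exists i, k; apply/negP.
have [r ur] : exists r,
    row r (sigma (block (delta_mx k k : 'M[K]_((d i).+1)))) != 0.
  apply: contrapT => h; move/eqP: Eik; apply; apply/row_matrixP => r.
  by rewrite row0; apply/eqP/negP => E0; apply: h; exists r; apply/negP.
pose E l := sigma (block (delta_mx k l : 'M[K]_((d i).+1))).
pose U := \matrix_(l < (d i).+1) (row r (E k) *m E l).
have EE l : E k *m E l = E l.
  by rewrite /E -[_ *m _]/(_ * _) -rmorphM blockM -[X in block X]/(_ *m _)
    mul_delta_mx.
have Uint a : U *m sigma a = rho i a *m U.
  apply/row_matrixP => l; rewrite row_mul rowK -mulmxA -[E l *m _]/(_ * _).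
  rewrite /E -rmorphM block_mulr row_mul [RHS]mulmx_sum_row.
  have -> : delta_mx k l * rho i a = \sum_j rho i a l j *: delta_mx k j.
    apply/matrixP => p s; rewrite !mxE summxE (bigD1 l) //= [RHS](bigD1 s) //=.
    rewrite !big1 ?addr0 => [|t ts|t tl].
    - by rewrite !mxE !eqxx !andbT mulrC.
    - by rewrite !mxE [s == t]eq_sym (negPf ts) andbF mulr0.
    - by rewrite !mxE (negPf tl) andbF mul0r.
  rewrite (linear_sum (@block i)) rmorph_sum mulmx_sumr; apply: eq_bigr => j _.
  by rewrite rowK linearZ /= linearZ /= -scalemxAr [in RHS]mxE.
have Uk : row k U = row r (E k) by rewrite rowK -row_mul EE.
have U_neq0 : U != 0 by apply: contraNneq ur => U0; rewrite -Uk U0 row0.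
have Ufull : row_full U.
  rewrite -(eq_row_full (genmxE U)); apply: sirr => [a|].
    by rewrite (eqmxMr _ (genmxE U)) genmxE Uint submxMl.
  by rewrite -mxrank_eq0 genmxE mxrank_eq0.
have Ufree : row_free U.
  apply: inj_row_free => v vU; apply/rowP => p; rewrite mxE.
  have := congr1 (mulmx^~ (sigma (block (delta_mx p k)))) vU.
  rewrite mul0mx -mulmxA Uint repr_block mulmxA.
  have -> : v *m delta_mx p k = v 0 p *: delta_mx 0 k.
    apply/rowP => s; rewrite !mxE (bigD1 p) //= big1 ?addr0 => [|t tp].
      by rewrite !mxE !eqxx.
    by rewrite !mxE (negPf tp) mulr0.
  rewrite -scalemxAl -rowE Uk => /eqP; rewrite scaler_eq0 (negPf ur) orbF.
  by move/eqP.
have /row_freeP[V UV] := Ufree.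
have VU : V *m U = 1%:M.
  have /row_fullP[V' V'U] := Ufull.
  by rewrite -(mul1mx V) -V'U -(mulmxA V') UV mulmx1.
exists i; apply/funext => a; rewrite fE -[sigma a]mul1mx -VU -mulmxA Uint.
by rewrite mxtrace_mulC -mulmxA UV mulmx1.
Qed.
End SplitSemisimple.

(** * Symmetric algebras and dual bases *)

Section SymmetricAlgebra.
Variables (k : comNzRingType) (A : algType k) (I : finType).
Variables (tau : {scalar A}) (b b' : I -> A).
Hypothesis tauC : forall x y, tau (x * y) = tau (y * x).
Hypothesis b_basis : is_basis b.
Hypothesis bb' : dual_basis tau b b'.

Lemma basis_free (c : I -> k) : \sum_i c i *: b i = 0 -> forall i, c i = 0.
Proof.
move=> c0 i; have [e [_ eu]] := b_basis 0.
have e0 : e = [ffun=> 0].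
  by apply: eu; rewrite big1 // => j _; rewrite ffunE scale0r.
have /ffunP/(_ i) : e = [ffun j => c j].
  by apply: eu; rewrite -[LHS]c0; apply: eq_bigr => j _; rewrite ffunE.
by rewrite e0 !ffunE.
Qed.

Lemma dual_coord (c : I -> k) j : tau ((\sum_i c i *: b i) * b' j) = c j.
Proof.
rewrite mulr_suml linear_sum (bigD1 j) //= big1 ?addr0 => [|i ij].
  by rewrite -scalerAl linearZ /= bb' eqxx mulr1.
by rewrite -scalerAl linearZ /= bb' (negPf ij) mulr0.
Qed.

Lemma basis_expand x : x = \sum_i tau (x * b' i) *: b i.
Proof.
have [c [-> _]] := b_basis x.
by apply: eq_bigr => i _; rewrite dual_coord.
Qed.

Lemma trace_nondegenerate x : (forall y, tau (x * y) = 0) -> x = 0.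
Proof.
by move=> x0; rewrite (basis_expand x) big1 // => i _; rewrite x0 scale0r.
Qed.

Lemma dual_expand x : x = \sum_i tau (b i * x) *: b' i.
Proof.
apply/eqP; rewrite -subr_eq0; apply/eqP/trace_nondegenerate => y.
rewrite tauC (basis_expand y) mulr_suml linear_sum big1 // => j _.
rewrite -scalerAl linearZ /= mulrBr linearB /= mulr_sumr linear_sum /=.
rewrite (bigD1 j) //= big1 => [|i ij]; rewrite -scalerAr linearZ /= bb'.
  by rewrite eqxx mulr1 addr0 subrr mulr0.
by rewrite eq_sym (negPf ij) mulr0.
Qed.

(** Moving [a] across the sum: the coordinates of a * b i in [b] are the
    coordinates of b' i * a in [b'], transposed. *)
Lemma casimir_central x : central (\sum_i b i * x * b' i).
Proof.
move=> a; rewrite mulr_suml mulr_sumr.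
under eq_bigr => i _ do
  rewrite -(mulrA (b i * x)) (dual_expand (b' i * a)) mulr_sumr.
under [RHS]eq_bigr => i _ do
  rewrite !mulrA (basis_expand (a * b i)) !mulr_suml.
rewrite exchange_big; apply: eq_bigr => i _; apply: eq_bigr => j _ /=.
by rewrite -scalerAr -!scalerAl; congr (_ *: _); rewrite mulrA tauC mulrA.
Qed.

(** The element that represents the linear form [f] under the trace form. *)
Definition dual_elt (f : A -> k) : A := \sum_i f (b' i) *: b i.

Lemma dual_eltP (f : {scalar A}) x : tau (dual_elt f * x) = f x.
Proof.
rewrite [in RHS](dual_expand x) linear_sum mulr_suml linear_sum /=.
apply: eq_bigr => i _; rewrite linearZ /= -scalerAl linearZ /=.
exact: mulrC.
Qed.

Lemma dual_elt_central (f : {scalar A}) :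
  (forall x y, f (x * y) = f (y * x)) -> central (dual_elt f).
Proof.
move=> fC a; apply/eqP; rewrite -subr_eq0; apply/eqP/trace_nondegenerate => x.
rewrite mulrBl linearB /= -mulrA dual_eltP -mulrA [tau (a * _)]tauC -mulrA.
by rewrite dual_eltP fC subrr.
Qed.

End SymmetricAlgebra.

Section ScalarExtension.
Variables (k K : comNzRingType) (phi : {rmorphism k -> K}).
Variables (A : algType k) (B : algType K) (iota : {rmorphism A -> B}).
Variables (I : finType) (tau : {scalar A}) (b b' : I -> A).
Hypothesis ext : scalar_extension phi iota.
Hypothesis tauC : forall x y, tau (x * y) = tau (y * x).
Hypothesis b_basis : is_basis b.
Hypothesis bb' : dual_basis tau b b'.

Lemma scalar_extension_form (f : {scalar A}) :
  exists g : {scalar B}, forall x, g (iota x) = phi (f x).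
Proof.
have [_ ext_univ] := ext.
have [|g gE _] := ext_univ K^o (phi \o f).
  by move=> r x /=; rewrite linearZ rmorphM.
by exists g => x; rewrite gE.
Qed.

(** That the [iota (b i)] span [B] comes from the uniqueness half of the
    universal property: the identity of [B] and the expansion map [G] below
    agree on the image of [iota]. They are independent because the extended
    trace form reads off coordinates. *)
Lemma scalar_extension_symmetric :
  exists tauB : {scalar B},
    [/\ forall x, tauB (iota x) = phi (tau x),
        forall x y, tauB (x * y) = tauB (y * x),
        is_basis (fun i => iota (b i)) &
        dual_basis tauB (fun i => iota (b i)) (fun i => iota (b' i))].
Proof.
have [tauB tauBE] := scalar_extension_form tau.
have [iotaZ ext_univ] := ext.
have BB' : dual_basis tauB (fun i => iota (b i)) (fun i => iota (b' i)).
  by move=> i j; rewrite -rmorphM tauBE bb' rmorph_nat.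
pose G x := \sum_i tauB (x * iota (b' i)) *: iota (b i).
have Glin : linear G.
  move=> c x y; rewrite /G scaler_sumr -big_split; apply: eq_bigr => i _ /=.
  by rewrite mulrDl linearD /= -scalerAl linearZ scalerDl scalerA.
pose GL : {linear B -> B} := HB.pack G (GRing.isLinear.Build _ _ _ _ G Glin).
have [|g _ gU] := ext_univ B iota; first exact: iotaZ.
have GE x : x = G x.
  rewrite -[x in LHS]/(idfun x) (gU idfun) // -(gU GL) // => y /=.
  rewrite /G [in RHS](basis_expand b_basis bb' y) rmorph_sum.
  by apply: eq_bigr => i _; rewrite /= iotaZ -rmorphM tauBE.
exists tauB; split=> // [x y|x].
  rewrite (GE x) (GE y) mulr_suml mulr_sumr !linear_sum /=.
  apply: eq_bigr => i _.
  rewrite mulr_sumr mulr_suml !linear_sum; apply: eq_bigr => j _ /=.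
  rewrite -!scalerAl -!scalerAr !linearZ /= -!rmorphM !tauBE tauC.
  by rewrite mulrCA.
exists [ffun i => tauB (x * iota (b' i))]; split=> [|c ->].
  by rewrite [LHS]GE; apply: eq_bigr => i _; rewrite ffunE.
by apply/ffunP => i; rewrite ffunE (dual_coord BB').
Qed.

End ScalarExtension.

(** * The center and the character matrix *)

Lemma sum_enum_val (V : nmodType) (J : finType) (F : J -> V) :
  \sum_C F C = \sum_(j < #|J|) F (enum_val j).
Proof. by rewrite (reindex (@enum_val J J)) //; apply/onW_bij/enum_val_bij. Qed.

Lemma irr_char_linear (K : fieldType) (A : algType K) (chi : A -> K) :
  irr_char chi ->
  exists2 f : {scalar A}, chi = f & forall x y, f (x * y) = f (y * x).
Proof.
case=> d [rho [_ chiE]]; exists (mxtrace \o rho); first exact/funext.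
by move=> x y /=; rewrite !rmorphM /= mxtrace_mulC.
Qed.

Section CharacterMatrix.
Variables (K : fieldType) (A : algType K) (J : finType) (y : J -> A).
Variable chi : 'I_#|J| -> A -> K.
Local Notation P := (\matrix_(i < #|J|, j < #|J|) chi i (y (enum_val j))).
Hypothesis P_unit : P \in unitmx.

Lemma char_matrix_solve (t : 'I_#|J| -> K) :
  exists! g : {ffun J -> K}, forall i, t i = \sum_C g C * chi i (y C).
Proof.
have PE (g : {ffun J -> K}) :
    (forall i, t i = \sum_C g C * chi i (y C)) <->
    P *m (\col_j g (enum_val j)) = \col_i t i.
  split=> [tE|/colP tE i]; first apply/colP => i; last have := tE i.
    rewrite !mxE tE [RHS]sum_enum_val; apply: eq_bigr => j _.
    by rewrite !mxE mulrC.
  rewrite !mxE => <-; rewrite [RHS]sum_enum_val; apply: eq_bigr => j _.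
  by rewrite !mxE mulrC.
exists [ffun C => (invmx P *m \col_i t i) (enum_rank C) 0]; split=> [|g /PE tE].
  apply/PE; rewrite -[RHS](mulKVmx P_unit); congr (_ *m _).
  by apply/colP => j; rewrite mxE ffunE enum_valK.
apply/ffunP => C; rewrite ffunE -tE mulKmx // mxE enum_rankK //.
Qed.

Lemma char_matrix_inv (M : lmodType K) (z : J -> M) (u : 'I_#|J| -> M) :
    (forall i, u i = \sum_C chi i (y C) *: z C) ->
  forall C, z C = \sum_i invmx P (enum_rank C) i *: u i.
Proof.
move=> uE C; under eq_bigr => i _ do rewrite uE scaler_sumr.
rewrite exchange_big (bigD1 C) //= [X in _ + X]big1 ?addr0 => [|D DC].
  under eq_bigr => i _ do rewrite scalerA.
  rewrite -scaler_suml.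
  rewrite (_ : \sum_i _ = (invmx P *m P) (enum_rank C) (enum_rank C)).
    by rewrite mulVmx // mxE eqxx scale1r.
  by rewrite mxE; apply: eq_bigr => i _; rewrite !mxE enum_rankK.
under eq_bigr => i _ do rewrite scalerA.
rewrite -scaler_suml.
rewrite (_ : \sum_i _ = (invmx P *m P) (enum_rank C) (enum_rank D)).
  by rewrite mulVmx // mxE (inj_eq enum_rank_inj) eq_sym (negPf DC) scale0r.
by rewrite mxE; apply: eq_bigr => i _; rewrite !mxE enum_rankK.
Qed.
End CharacterMatrix.

Section CenterBasis.
Variables (K : fieldType) (A : algType K) (I J : finType).
Variables (tau : {scalar A}) (b b' : I -> A) (v : J -> I).
Hypothesis tauC : forall x y, tau (x * y) = tau (y * x).
Hypothesis b_basis : is_basis b.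
Hypothesis bb' : dual_basis tau b b'.
Hypothesis A_split : split_semisimple A.
Hypothesis invertible : char_matrix_invertible (fun C => b' (v C)).

Lemma char_coef_exists_unique w :
  exists! gw : {ffun J -> K}, forall chi : A -> K, irr_char chi ->
    chi (b' w) = \sum_C gw C * chi (b' (v C)).
Proof.
have [chi [[chi_inj chi_irr] P_unit]] := invertible.
have [g [gE gU]] :=
  @char_matrix_solve _ _ _ (b' \o v) chi P_unit (fun i => chi i (b' w)).
exists g; split=> [f /chi_irr[i ->] //|h hE].
by apply: gU => i; apply: hE; apply/chi_irr; exists i.
Qed.

(** The dual elements of the irreducible characters span the center, and are
    related to the [z C] by the invertible character matrix. *)
Lemma char_coef_center_basis (g : I -> J -> K) :
    (forall chi : A -> K, irr_char chi -> forall w,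
       chi (b' w) = \sum_C g w C * chi (b' (v C))) ->
  is_center_basis (fun C => \sum_w g w C *: b w).
Proof.
move=> gE; set z := fun C => _.
have dualE f : irr_char f -> dual_elt b b' f = \sum_C f (b' (v C)) *: z C.
  move=> f_irr; rewrite /dual_elt.
  under eq_bigr => w _ do rewrite (gE f f_irr) scaler_suml.
  rewrite exchange_big; apply: eq_bigr => C _; rewrite /z scaler_sumr.
  by apply: eq_bigr => w _; rewrite scalerA mulrC.
have [chi [[chi_inj chi_irr] P_unit]] := invertible.
have chiP i : irr_char (chi i) by apply/chi_irr; exists i.
split=> [C|x xC].
  have -> := @char_matrix_inv _ _ _ (b' \o v) chi P_unit _ _ _
    (fun i => dualE _ (chiP i)) C.
  move=> a; rewrite mulr_suml mulr_sumr; apply: eq_bigr => i _.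
  have [f fE fC] := irr_char_linear (chiP i).
  by rewrite -scalerAl -scalerAr fE (dual_elt_central tauC b_basis bb' fC).
have [m [d [rho rhoP]]] := A_split.
have [c cE] : exists c, forall a, tau (x * a) = \sum_i c i * \tr (rho i a).
  have tx_lin : linear_for *%R (fun a => tau (x * a)).
    by move=> r a a'; rewrite mulrDr linearD /= -scalerAr linearZ.
  pose f : {scalar A} := HB.pack (fun a => tau (x * a))
    (GRing.isLinear.Build _ _ _ _ (fun a => tau (x * a)) tx_lin).
  apply: (trace_function_expand rhoP (f := f)) => a a' /=.
  by rewrite mulrA xC -mulrA tauC mulrA.
have xE : x = \sum_C (\sum_i c i * \tr (rho i (b' (v C)))) *: z C.
  under eq_bigr => C _ do rewrite scaler_suml.
  rewrite exchange_big [LHS](basis_expand b_basis bb').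
  under [LHS]eq_bigr => w _ do rewrite cE scaler_suml.
  rewrite [LHS]exchange_big; apply: eq_bigr => i _ /=.
  transitivity (c i *: dual_elt b b' (fun a => \tr (rho i a))).
    by rewrite scaler_sumr; apply: eq_bigr => w _; rewrite scalerA.
  rewrite dualE; last exact: joint_char_irr.
  by rewrite scaler_sumr; apply: eq_bigr => C _; rewrite scalerA.
(* The coefficient of [b (v D)] in [z C] is 1 if C = D and 0 otherwise. *)
have z_coord (e : J -> K) : \sum_C e C *: z C = 0 -> forall D, e D = 0.
  move=> e0 D; have [g1 [_ g1U]] := char_coef_exists_unique (v D).
  have gD C : g (v D) C = (C == D)%:R.
    have g1E : g1 = [ffun C => g (v D) C].
      apply: g1U => f f_irr; rewrite (gE f) //.
      by apply: eq_bigr => ? _; rewrite ffunE.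
    have /ffunP/(_ C) : g1 = [ffun C => (C == D)%:R].
      apply: g1U => f _; rewrite (bigD1 D) //= big1 ?addr0 => [|C' C'D].
        by rewrite ffunE eqxx mul1r.
      by rewrite ffunE (negPf C'D) mul0r.
    by rewrite g1E !ffunE.
  have : \sum_w (\sum_C e C * g w C) *: b w = 0.
    rewrite -[RHS]e0; under [LHS]eq_bigr => w _ do rewrite scaler_suml.
    rewrite [LHS]exchange_big; apply: eq_bigr => C _.
    by rewrite scaler_sumr; apply: eq_bigr => w _; rewrite scalerA.
  move/(basis_free b_basis)/(_ (v D)).
  rewrite (bigD1 D) //= big1 => [|C CD]; first by rewrite gD eqxx mulr1 addr0.
  by rewrite gD (negPf CD) mulr0.
exists [ffun C => \sum_i c i * \tr (rho i (b' (v C)))]; split=> [|e eE].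
  by rewrite {1}xE; apply: eq_bigr => C _; rewrite ffunE.
apply/ffunP => D; rewrite ffunE; apply/eqP; rewrite -subr_eq0; apply/eqP.
apply: (z_coord (fun D => _ - e D)).
under eq_bigr => C _ do rewrite scalerBl.
by rewrite sumrB -xE -eE subrr.
Qed.
End CenterBasis.

(** * Specialisation of square matrices *)

(** A determinant over [k] that is nonzero after [sp] is nonzero after [phi].
    Stated for families indexed by a finite type, since the matrices at hand
    are indexed by a group or by its conjugacy classes. *)
Lemma specialise_nondegenerate (k : comNzRingType) (K L : fieldType)
    (phi : {rmorphism k -> K}) (sp : {rmorphism k -> L}) (I : finType)
    (N : I -> I -> k) :
    (forall r, phi r = 0 -> sp r = 0) ->
    (forall c : I -> L, (forall u, \sum_w c w * sp (N w u) = 0) ->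
       forall w, c w = 0) ->
  forall x : I -> K, (forall w, \sum_u phi (N w u) * x u = 0) ->
    forall u, x u = 0.
Proof.
move=> ker_phi N_free x x0.
pose M : 'M[k]_#|I| := \matrix_(i, j) N (enum_val i) (enum_val j).
have spM : map_mx sp M \in unitmx.
  rewrite -row_free_unit; apply: inj_row_free => c cM; apply/rowP => i.
  rewrite mxE -(enum_valK i).
  apply: (N_free (fun w => c 0 (enum_rank w))) => u.
  have /rowP/(_ (enum_rank u)) := cM; rewrite !mxE => cu.
  rewrite -[RHS]cu.
  rewrite [LHS]sum_enum_val; apply: eq_bigr => j _.
  by rewrite !mxE enum_valK enum_rankK.
have phiM : map_mx phi M \in unitmx.
  move: spM; rewrite !unitmxE !det_map_mx !unitfE.
  by apply: contraNneq => /ker_phi ->.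
pose X := \col_(j < #|I|) x (enum_val j).
have X0 : X = 0.
  rewrite -(mulKmx phiM X) (_ : map_mx phi M *m X = 0) ?mulmx0 //.
  apply/colP => i; rewrite !mxE -[RHS](x0 (enum_val i)) [RHS]sum_enum_val.
  by apply: eq_bigr => j _; rewrite !mxE.
by move=> u; have /colP/(_ (enum_rank u)) := X0; rewrite !mxE enum_rankK.
Qed.

(** * Group algebras and conjugacy classes *)

Section GroupAlgebraCoef.
Variables (L : comNzRingType) (W : groupType).

Lemma galg_coef0 g : galg_coef (0 : group_algebra L W) g = 0.
Proof. exact: mcoeff0. Qed.

Lemma galg_coef_sum (I : finType) (c : I -> L) (x : I -> group_algebra L W) g :
  galg_coef (\sum_i c i *: x i) g = \sum_i c i * galg_coef (x i) g.
Proof.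
rewrite (big_morph (fun y : group_algebra L W => galg_coef y g)
  (id1 := 0) (op1 := +%R)).
- by apply: eq_bigr => i _; rewrite galg_coefZ.
- by move=> x1 y1; rewrite galg_coefD.
exact: galg_coef0.
Qed.

Lemma galg_coef_elt (g h : W) : galg_coef (galg_elt L g) h = (g == h)%:R :> L.
Proof. by rewrite galg_coef_mono. Qed.

Lemma galg_coefB (x y : group_algebra L W) g :
  galg_coef (x - y) g = galg_coef x g - galg_coef y g.
Proof. exact: mcoeffB. Qed.
End GroupAlgebraCoef.

Section ConjugacyClasses.
Variable W : finGroupType.

Fact class_of_subproof (w : W) : (w ^: [set: W])%g \in classes [set: W].
Proof. by apply: imset_f; rewrite finset.in_setT. Qed.

Definition class_of (w : W) : conj_class W := 
  exist _ (w ^: [set: W])%g (class_of_subproof w).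

Lemma mem_conj_class (C : conj_class W) w : (w \in val C) = (class_of w == C).
Proof.
case: C => D Dcl; have /imsetP[x _ DE] := Dcl.
rewrite -val_eqE /= {Dcl}DE; apply/idP/eqP => [|<-]; last exact: class_refl.
by move=> /class_eqP.
Qed.

Lemma class_of_conj (w g : W) : class_of (w ^ g)%g = class_of w.
Proof. by apply: val_inj; rewrite /= classGidl ?finset.in_setT. Qed.

Lemma class_sum_central (L : comNzRingType) (C : conj_class W) (g : W) :
  galg_elt L g * (\sum_(h in val C) galg_elt L h) =
  (\sum_(h in val C) galg_elt L h) * galg_elt L g.
Proof.
rewrite mulr_sumr mulr_suml (reindex_inj (conjg_inj g)).
apply: eq_big => [h|h _]; first by rewrite !mem_conj_class class_of_conj.
by rewrite -!galg_eltM -conjgC.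
Qed.
End ConjugacyClasses.

(** * Algebras specialising to a group algebra *)

Section Deformation.
Variables (k : comNzRingType) (K : fieldType) (L : numFieldType).
Variables (phi : {rmorphism k -> K}) (sp : {rmorphism k -> L}).
Hypothesis ker_phi : forall r, phi r = 0 -> sp r = 0.
Variables (W : finGroupType) (A : algType k) (B : algType K).
Variables (iota : {rmorphism A -> B}) (tau : {scalar A}) (b b' : W -> A).
Variable v : conj_class W -> W.
Hypothesis ext : scalar_extension phi iota.
Hypothesis tauC : forall x y, tau (x * y) = tau (y * x).
Hypothesis b_basis : is_basis b.
Hypothesis bb' : dual_basis tau b b'.
Hypothesis vP : forall C, v C \in val C.
Variable theta : {rmorphism A -> group_algebra L W}.
Hypothesis thetaZ : forall r x, theta (r *: x) = sp r *: theta x.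
Hypothesis theta_b : forall w, theta (b w) = galg_elt L w.

(** By duality tau (x * b' u) is the coordinate of [x] at [b u], and [theta]
    sends [b u] to u. *)
Lemma coef_specialise x u : galg_coef (theta x) u = sp (tau (x * b' u)).
Proof.
rewrite {1}(basis_expand b_basis bb' x) rmorph_sum.
under eq_bigr => w _ do rewrite /= thetaZ theta_b.
rewrite galg_coef_sum (bigD1 u) //= big1 => [|w wu].
  by rewrite galg_coef_elt eqxx mulr1 addr0.
by rewrite galg_coef_elt (negPf wu) mulr0.
Qed.

(** The specialised trace form of [x] with [y] depends linearly on the image of
    [x], although [theta] is only semilinear and need not be onto. *)
Lemma trace_specialise x y :
  sp (tau (x * y)) = \sum_u galg_coef (theta x) u * sp (tau (b u * y)).
Proof.
rewrite [in LHS](basis_expand b_basis bb' x) mulr_suml linear_sum rmorph_sum.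
apply: eq_bigr => u _; rewrite /= -scalerAl linearZ /= rmorphM.
by rewrite coef_specialise.
Qed.

Lemma specialise_trace0 x : theta x = 0 -> sp (tau x) = 0.
Proof.
move=> x0; rewrite -[x]mulr1 trace_specialise big1 // => u _.
by rewrite x0 galg_coef0 mul0r.
Qed.

Lemma class_v C : class_of (v C) = C.
Proof. by apply/eqP; rewrite -mem_conj_class. Qed.

(** Conjugate elements differ by a commutator: for w = g^-1 v g take
    x = g^-1 v and y = g. *)
Lemma conjugate_commutator w :
  exists x y, theta (b x * b y - b y * b x) =
    galg_elt L w - galg_elt L (v (class_of w)).
Proof.
set C := class_of w.
have : w \in val C by rewrite mem_conj_class.
have -> : val C = (v C ^: [set: W])%g.
  by rewrite -[C in LHS]class_v.
case/imsetP=> g _ ->; exists (g^-1 * v C)%g, g.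
rewrite rmorphB !rmorphM !theta_b -!galg_eltM /= conjgE.
by rewrite mulgA mulgV mul1g mulgA.
Qed.

(** A family whose members are killed by every trace function, except for the
    [b' (v C)]. *)
Definition class_lift (e : W -> A) : Prop := forall w,
  (w = v (class_of w) -> e w = b' w) /\
  (w != v (class_of w) -> exists x y, e w = b x * b y - b y * b x /\
     theta (e w) = galg_elt L w - galg_elt L (v (class_of w))).

Lemma class_lift_exists : exists e, class_lift e.
Proof.
suff /choice[e eP] : forall w, exists ew : A,
    (w = v (class_of w) -> ew = b' w) /\
    (w != v (class_of w) -> exists x y, ew = b x * b y - b y * b x /\
     theta ew = galg_elt L w - galg_elt L (v (class_of w))).
  by exists e.
move=> w; have [wv|wv] := eqVneq w (v (class_of w)).
  by exists (b' w); split.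
have [x [y xyE]] := conjugate_commutator w.
exists (b x * b y - b y * b x); split=> [wE|_]; last by exists x, y.
by rewrite -wE eqxx in wv.
Qed.

(** The family specialises to a basis of the group algebra. In a linear
    relation, pairing with the class sum of D, which is central, kills the
    commutators and leaves the coefficient of [b' (v D)], by duality; what
    remains is a relation between the w - v_C, in which each w that is not a
    representative occurs once. *)
Lemma class_lift_free e (c : W -> L) : class_lift e ->
  (forall u, \sum_w c w * sp (tau (e w * b' u)) = 0) -> forall w, c w = 0.
Proof.
move=> eP ce; pose kD (D : conj_class W) := \sum_(g in val D) b g.
have cD D : c (v D) = 0.
  have : \sum_w c w * sp (tau (e w * kD D)) = 0.
    under eq_bigr => w _ do rewrite trace_specialise mulr_sumr.
    rewrite exchange_big big1 // => u _ /=.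
    under eq_bigr => w _ do rewrite coef_specialise mulrA.
    by rewrite -mulr_suml ce mul0r.
  rewrite (bigD1 (v D)) //= big1 ?addr0 => [|w wD]; last first.
    have [wv|wv] := eqVneq w (v (class_of w)).
      rewrite (eP w).1 // tauC mulr_suml linear_sum.
      rewrite big1 ?rmorph0 ?mulr0 // => g gD.
      rewrite /= bb'; case: eqVneq => // gw; case/eqP: wD.
      by move: gD; rewrite gw mem_conj_class => /eqP <-.
    have [x [y [-> _]]] := (eP w).2 wv.
    (* As class sums are central, [theta] kills the bracket on the right. *)
    have -> : tau ((b x * b y - b y * b x) * kD D) =
        tau (b x * (b y * kD D - kD D * b y)).
      rewrite mulrBl mulrBr !linearB /= !mulrA; congr (_ - _).
      by rewrite -(mulrA (b y)) tauC.
    rewrite specialise_trace0 ?mulr0 // rmorphM rmorphB !rmorphM /=.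
    have -> : theta (kD D) = \sum_(g in val D) galg_elt L g.
      by rewrite rmorph_sum; apply: eq_bigr => g _; rewrite /= theta_b.
    by rewrite !theta_b class_sum_central subrr mulr0.
  rewrite (eP (v D)).1 ?class_v // tauC mulr_suml linear_sum (bigD1 (v D)) //=.
  rewrite big1 ?addr0 => [|g /andP[_ gD]]; last by rewrite bb' (negPf gD).
  by rewrite bb' eqxx rmorph1 mulr1.
move=> u; have [->|uv] := eqVneq u (v (class_of u)); first exact: cD.
have := ce u; rewrite (bigD1 u) //= big1 ?addr0 => [|w wu].
  have [x [y [_ eu]]] := (eP u).2 uv.
  rewrite -coef_specialise eu galg_coefB !galg_coef_elt eqxx.
  by rewrite eq_sym (negPf uv) subr0 mulr1.
have [->|wv] := eqVneq w (v (class_of w)); first by rewrite cD mul0r.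
have [x [y [_ ew]]] := (eP w).2 wv.
rewrite -coef_specialise ew galg_coefB !galg_coef_elt (negPf wu).
case: eqVneq => [vu|]; last by rewrite subrr mulr0.
by move: uv; rewrite -vu class_v eqxx.
Qed.

(** A trace function vanishes on commutators, so it is determined on the basis
    [class_lift] of [B] by its values at the [b' (v C)]. *)
Lemma trace_function_eq0 (f : {scalar B}) :
    (forall x y, f (x * y) = f (y * x)) ->
    (forall C, f (iota (b' (v C))) = 0) ->
  forall x, f x = 0.
Proof.
move=> fC fv; have [e eP] := class_lift_exists.
have [_ [_ _ B_basis _]] := scalar_extension_symmetric ext tauC b_basis bb'.
have [iotaZ _] := ext.
have f0 : forall u, f (iota (b u)) = 0.
  apply: (specialise_nondegenerate (N := fun w u => tau (e w * b' u)) ker_phi).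
    by move=> c; apply: class_lift_free.
  move=> w; transitivity (f (iota (e w))).
    rewrite [in RHS](basis_expand b_basis bb' (e w)) rmorph_sum linear_sum.
    by apply: eq_bigr => u _; rewrite /= iotaZ linearZ.
  have [wv|wv] := eqVneq w (v (class_of w)).
    by rewrite (eP w).1 // wv fv.
  have [x [y [-> _]]] := (eP w).2 wv.
  by rewrite rmorphB !rmorphM linearB /= fC subrr.
move=> x; have [c [-> _]] := B_basis x.
by rewrite linear_sum big1 // => u _; rewrite linearZ /= f0 mulr0.
Qed.

(** There are at least as many independent trace functions on [B] as conjugacy
    classes, namely the pairings with the central elements
    sum_w b_w b_{v_C} b'_w. Over the group algebra the value at g of such a
    trace function is the number of w with g w v_C = w. *)
Lemma card_conj_class_le m (chi : 'I_m -> B -> K) :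
    (forall f : {scalar B}, (forall x y, f (x * y) = f (y * x)) ->
       exists c : 'I_m -> K, forall a, f a = \sum_i c i * chi i a) ->
  (#|conj_class W| <= m)%N.
Proof.
move=> chi_span.
have [tauB [tauBE tauBC B_basis BB']] :=
  scalar_extension_symmetric ext tauC b_basis bb'.
pose z C := \sum_w b w * b (v C) * b' w.
have zC C : central (iota (z C)).
  rewrite /z rmorph_sum; under eq_bigr => w _ do rewrite /= !rmorphM.
  exact: (casimir_central tauBC B_basis BB').
pose y D := b (v D)^-1%g.
have zyE C D : sp (tau (z C * y D)) =
    \sum_w ((v D)^-1 * w * v C == w)%g%:R.
  rewrite mulr_suml linear_sum rmorph_sum; apply: eq_bigr => w _ /=.
  rewrite tauC !mulrA -coef_specialise !rmorphM !theta_b -!galg_eltM.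
  exact: galg_coef_elt.
have f_span C : exists c : 'I_m -> K, forall a,
    tauB (iota (z C) * a) = \sum_i c i * chi i a.
  have f_lin : linear_for *%R (fun a => tauB (iota (z C) * a)).
    by move=> r a a'; rewrite mulrDr linearD /= -scalerAr linearZ.
  pose f : {scalar B} := HB.pack (fun a => tauB (iota (z C) * a))
    (GRing.isLinear.Build _ _ _ _ (fun a => tauB (iota (z C) * a)) f_lin).
  apply: (chi_span f) => a a' /=.
  by rewrite mulrA zC -mulrA tauBC mulrA.
pose Q := \matrix_(D < #|conj_class W|, i < m) chi i (iota (y (enum_val D))).
suff : row_free Q by move=> /eqP <-; exact: rank_leq_col.
apply: inj_row_free => x xQ; apply/rowP => D; rewrite mxE -(enum_valK D).
move: (enum_val D) => {}D; move: D.
apply: (@specialise_nondegenerate _ _ _ _ _ _ (fun C D => tau (z C * y D))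
  ker_phi _ (fun D => x 0 (enum_rank D))) => [c cz C|C].
  have := cz C; rewrite (bigD1 C) //= big1 ?addr0 => [|D' D'C].
    move/eqP; rewrite mulf_eq0 => /orP[/eqP //|].
    rewrite zyE -natr_sum pnatr_eq0 sum_nat_eq0 => /forall_inP/(_ 1%g isT).
    by rewrite mulg1 mulVg eqxx.
  rewrite zyE big1 ?mulr0 // => w _; case: eqP => // vw.
  case/eqP: D'C; rewrite -(class_v D') -(class_v C) -(class_of_conj (v C) w).
  have wv : (w * v D' = v C * w)%g by rewrite -{2}vw !mulgA mulgV mul1g.
  by rewrite conjgE -wv mulKg.
have [c cE] := f_span C.
transitivity (\sum_i c i * (x *m Q) 0 i); last first.
  by rewrite xQ big1 // => i _; rewrite mxE mulr0.
under [RHS]eq_bigr => i _ do rewrite mxE mulr_sumr.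
rewrite [RHS]exchange_big sum_enum_val; apply: eq_bigr => j _ /=.
rewrite -tauBE rmorphM cE mulr_suml; apply: eq_bigr => i _.
by rewrite mxE enum_valK mulrA mulrAC.
Qed.

(** The rows of the matrix are independent since a combination of characters
    that vanishes at the [b' (v C)] is zero. The count of trace functions then
    forces the matrix to be square. *)
Lemma char_matrix_invertible_of_specialisation :
  split_semisimple B -> char_matrix_invertible (fun C => iota (b' (v C))).
Proof.
case=> m [d [rho rhoP]].
pose chi i a := \tr (rho i a).
have m_ge : (#|conj_class W| <= m)%N.
  apply: (card_conj_class_le (chi := chi)) => f.
  exact: trace_function_expand.
pose P := \matrix_(i < m, j < #|conj_class W|)
  chi i (iota (b' (v (enum_val j)))).
have P_free : row_free P.
  apply: inj_row_free => x xP; apply/rowP => i; rewrite mxE.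
  apply: (joint_chars_free rhoP (c := fun i => x 0 i)) => {}a.
  pose f0 a := \sum_i x 0 i * \tr (rho i a).
  have f_lin : linear_for *%R f0.
    move=> r a1 a2; rewrite /f0 mulr_sumr -big_split; apply: eq_bigr => j _ /=.
    by rewrite linearP /= linearP /= mulrDr mulrCA.
  pose f : {scalar B} := HB.pack f0 (GRing.isLinear.Build _ _ _ _ f0 f_lin).
  apply: (trace_function_eq0 (f := f)) => [a1 a2|C] /=.
    by apply: eq_bigr => j _; rewrite !rmorphM /= mxtrace_mulC.
  have /rowP/(_ (enum_rank C)) := xP; rewrite !mxE => <-.
  by apply: eq_bigr => j _; rewrite mxE enum_rankK.
have mE : m = #|conj_class W|.
  apply/eqP; rewrite eqn_leq m_ge andbT.
  by rewrite -[X in (X <= _)%N](eqP P_free) rank_leq_col.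
subst m; exists chi; split; last by rewrite -row_free_unit.
split; first exact: joint_char_inj rhoP.
move=> f; split; first exact: irr_char_joint.
by case=> i ->; apply: joint_char_irr.
Qed.

End Deformation.

(** * Evaluation of Laurent polynomials *)

Section LaurentEvaluation.
Variable I : finType.

Lemma laurent_eval_mono (K : fieldType) (a : I -> K) c (k : lattice I) :
  laurent_eval a (galg_mono c k) = c%:~R * \prod_i a i ^ expo k i.
Proof.
apply: (@galg_lin_mono int (lattice I) K
  (fun c k => c%:~R * \prod_i a i ^ expo k i)) => g.
by rewrite mul0r.
Qed.

Lemma laurent_evalD (K : fieldType) (a : I -> K) :
  {morph laurent_eval a : p q / p + q}.
Proof.
move=> p q; apply: (@galg_linD int (lattice I) K
  (fun c k => c%:~R * \prod_i a i ^ expo k i)) => [g|g c d].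
  by rewrite mul0r.
by rewrite rmorphD mulrDl.
Qed.

Lemma laurent_eval_rmorphism (K : fieldType) (a : I -> K) :
    (forall i, a i != 0) ->
  exists f : {rmorphism laurent I -> K}, f = laurent_eval a :> (_ -> _).
Proof.
move=> a0; pose f := laurent_eval a.
have f0 : f 0 = 0.
  exact: (@galg_lin0 int (lattice I) K
    (fun c k => c%:~R * \prod_i a i ^ expo k i)).
have fD : {morph f : p q / p + q} := laurent_evalD a.
have fsum (T : Type) (s : seq T) (F : T -> laurent I) :
    f (\sum_(x <- s) F x) = \sum_(x <- s) f (F x).
  exact: (big_morph f fD f0).
have fB : zmod_morphism f.
  by move=> p q; have := fD (p - q) q; rewrite subrK => ->; rewrite addrK.
have fM : monoid_morphism f.
  split.
    rewrite -[1]/(galg_mono 1 1%g) /f laurent_eval_mono mul1r big1 // => i _.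
    by rewrite /expo ffunE expr0z.
  move=> p q; have fE x : f x =
      \sum_(g <- galg_supp x) f (galg_mono (galg_coef x g) g).
    by rewrite -fsum; congr f; exact: galgE.
  have -> : p * q = \sum_(g <- galg_supp p) \sum_(h <- galg_supp q)
      galg_mono (galg_coef p g * galg_coef q h) (g * h)%g by [].
  rewrite fsum [f p]fE [f q]fE mulr_suml; apply: eq_bigr => g _.
  rewrite fsum mulr_sumr; apply: eq_bigr => h _.
  rewrite /f !laurent_eval_mono rmorphM mulrACA -big_split; congr (_ * _).
  apply: eq_bigr => i _ /=.
  by rewrite /expo ffunE expfzDr.
pose fR : {rmorphism laurent I -> K} := HB.pack f
  (GRing.isZmodMorphism.Build _ _ f fB) (GRing.isMonoidMorphism.Build _ _ f fM).
by exists fR.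
Qed.

(** Multiplying by a power of the variables turns a Laurent polynomial into a
    polynomial expression in the [s i], which no longer involves inverses and
    does not depend on [f]. *)
Lemma laurent_eval_clear (D : comNzRingType) (K : fieldType)
    (f : {rmorphism D -> K}) (s : I -> D) (M : nat) (p : laurent I) :
    (forall i, f (s i) != 0) ->
    (forall k i, k \in galg_supp p -> (`|expo k i| <= M)%N) ->
  laurent_eval (f \o s) p * \prod_i f (s i) ^+ M =
  f (\sum_(k <- galg_supp p)
       (galg_coef p k)%:~R * \prod_i s i ^+ `|(expo k i + M%:Z)%R|).
Proof.
move=> s0 pM; rewrite mulr_suml rmorph_sum.
rewrite big_seq [RHS]big_seq; apply: eq_bigr => k kp.
rewrite rmorphM rmorph_int -mulrA -big_split rmorph_prod; congr (_ * _).
apply: eq_bigr => i _ /=; rewrite rmorphXn /= !exprnP -expfzDr //.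
rewrite gez0_abs //; have := pM k i kp; lia.
Qed.

(** A Laurent polynomial that vanishes at generic values [s i] vanishes at any
    specialisation of these values to nonzero ones: clear denominators before
    specialising. *)
Lemma laurent_eval_eq0 (D : comNzRingType) (K L : fieldType)
    (f : {rmorphism D -> K}) (g : {rmorphism D -> L}) (s : I -> D) p :
    injective f -> (forall i, g (s i) != 0) ->
  laurent_eval (f \o s) p = 0 -> laurent_eval (g \o s) p = 0.
Proof.
move=> f_inj gs0 p0.
have fs0 i : f (s i) != 0.
  by apply: contraNneq (gs0 i) => fs0; rewrite (f_inj (s i) 0) ?rmorph0.
pose M := (\max_(k <- galg_supp p) \max_i `|expo k i|)%N.
have pM k i : k \in galg_supp p -> (`|expo k i| <= M)%N.
  move=> kp; apply: leq_trans (leq_bigmax_seq _ kp isT).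
  exact: (leq_bigmax (F := fun i => `|expo k i|%N)).
have := laurent_eval_clear fs0 pM; rewrite p0 mul0r => /esym.
rewrite -{1}(rmorph0 f) => /f_inj P0.
have /eqP := laurent_eval_clear gs0 pM; rewrite P0 rmorph0 mulf_eq0.
case/orP=> [/eqP //|/prodf_eq0[i _]].
by rewrite expf_eq0 (negPf (gs0 i)) andbF.
Qed.
End LaurentEvaluation.

(** * The Hecke ring *)

Section HeckeSpecialisation.
Variables (R : realType) (n : nat) (W : finGroupType).
Variable rho : mx_representation (Cplx R) [set: W] n.

Lemma index_root_neq0 (i : hecke_index rho) : index_root i != 0.
Proof.
rewrite /index_root /root_unity /cis; set t := (X in cos X).
apply/eqP => -[c0 s0]; have := cos2Dsin2 t.
by rewrite c0 s0 expr0n addr0 => /esym/eqP; rewrite oner_eq0.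
Qed.

(** The value of u_{s,j} in the polynomial ring in the v_{s,j}. *)
Definition hecke_monomial (N : nat) (i : hecke_index rho) :
    mpoly #|hecke_index rho| (Cplx R) :=
  mpolyC _ (index_root i) * mpolyX (Cplx R) (mnm1 (enum_rank i)) ^+ N.

Lemma hecke_to_fieldE N :
  hecke_to_field N = laurent_eval (@tofrac _ \o hecke_monomial N).
Proof.
rewrite /hecke_to_field; congr laurent_eval; apply/funext => i /=.
by rewrite rmorphM rmorphXn.
Qed.

Lemma hecke_specialE N :
  @hecke_special R n W rho =
    laurent_eval (meval (fun=> 1) \o hecke_monomial N).
Proof.
rewrite /hecke_special; congr laurent_eval; apply/funext => i /=.
by rewrite mevalM mevalC rmorphXn /= mevalXU expr1n mulr1.
Qed.

Lemma hecke_monomial_at1 N i : meval (fun=> 1) (hecke_monomial N i) != 0.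
Proof.
by rewrite mevalM mevalC rmorphXn /= mevalXU expr1n mulr1 index_root_neq0.
Qed.

(** The specialisation at v = 1 of the Hecke ring factors through its image in
    the field of the v_{s,j}. *)
Lemma hecke_special_ker N r :
  hecke_to_field N r = 0 -> @hecke_special R n W rho r = 0.
Proof.
rewrite hecke_to_fieldE (hecke_specialE N).
apply: laurent_eval_eq0; last exact: hecke_monomial_at1.
by move=> p q /eqP; rewrite tofrac_eq => /eqP.
Qed.
End HeckeSpecialisation.

Theorem theorem1p3 (R : realType) (n : nat) (W : finGroupType)
    (rho : mx_representation (Cplx R) [set: W] n)
    (x0 : complement_space rho)
    (H : algType (hecke_ring rho))
    (q : {lrmorphism group_algebra (hecke_ring rho) (braid_group x0) -> H})
    (N : nat) (HF : algType (hecke_field rho)) (iota : {rmorphism H -> HF})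
    (tau : {scalar H}) (b b' : W -> H) (v : conj_class W -> W) :
  complex_reflection_group rho ->
  is_hecke_algebra q ->
  (0 < N)%N ->
  scalar_extension (hecke_to_field N) iota ->
  split_semisimple HF ->
  symmetrising_trace tau ->
  is_basis b ->
  dual_basis tau b b' ->
  (forall C : conj_class W, v C \in val C) ->
  (forall theta : {rmorphism H -> group_algebra (Cplx R) W},
     is_specialisation q theta ->
     (forall w : W, theta (b w) = galg_elt (Cplx R) w) ->
     char_matrix_invertible (fun C => iota (b' (v C)))) /\
  (char_matrix_invertible (fun C => iota (b' (v C))) ->
     (forall w : W, exists! gw : {ffun conj_class W -> hecke_field rho},
        forall chi : HF -> hecke_field rho, irr_char chi ->
          chi (iota (b' w)) =
            \sum_(C : conj_class W) gw C * chi (iota (b' (v C)))) /\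
     (forall g : W -> conj_class W -> hecke_field rho,
        (forall chi : HF -> hecke_field rho, irr_char chi ->
           forall w : W,
             chi (iota (b' w)) =
               \sum_(C : conj_class W) g w C * chi (iota (b' (v C)))) ->
        is_center_basis
          (fun C : conj_class W => \sum_(w : W) g w C *: iota (b w)))).
Proof.
move=> _ _ _ ext HF_split [tauC _] b_basis bb' vP.
have [sp spE] := laurent_eval_rmorphism (@index_root_neq0 _ _ _ rho).
have [phi phiE] : exists phi : {rmorphism hecke_ring rho -> hecke_field rho},
    phi = hecke_to_field N :> (_ -> _).
  rewrite hecke_to_fieldE; apply: laurent_eval_rmorphism => i /=.
  rewrite tofrac_eq0; apply: contraNneq (hecke_monomial_at1 N i) => ->.
  by rewrite rmorph0.
rewrite -phiE in ext.
have ker_phi r : phi r = 0 -> sp r = 0.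
  by rewrite phiE spE; exact: (@hecke_special_ker _ _ _ rho N).
split=> [theta [thetaZ _] theta_b|invertible].
  apply: (char_matrix_invertible_of_specialisation ker_phi ext tauC b_basis bb'
    vP _ theta_b HF_split).
  by move=> r x; rewrite thetaZ spE.
have [tauF [_ tauFC BF_basis BBF']] :=
  scalar_extension_symmetric ext tauC b_basis bb'.
split=> [w|g gE]; first
  exact: (@char_coef_exists_unique _ _ _ _ (fun w => iota (b' w)) v invertible).
exact: (@char_coef_center_basis _ _ _ _ _ _ (fun w => iota (b' w)) v tauFC
  BF_basis BBF' HF_split invertible).
Qed.
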